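(* Let $\mathbf{k}$ be an arbitrary field, let $C$ be a smooth projective geometrically connected curve of genus $g$ over $\mathbf{k}$, and let $\{A_d\}_{d\ge 1}$ be a sequence of line bundles on $C$ of strictly increasing degree with $\deg A_d\ge 2g+1$ for all $d$. For each $d$, let $$\overline{\beta}(\mathcal{O}_C,A_d)=\sum_{i=0}^{g} c_{i,d}\cdot \pi_{i,d}$$ be the Boij--Söderberg decomposition of the rescaled Betti table $\overline{\beta}(\mathcal{O}_C,A_d)=\frac{1}{\deg A_d}\beta(\mathcal{O}_C,A_d)$; that is, $c_{i,d}\in\mathbb{Q}_{\ge 0}$ is the coefficient of the pure diagram $\pi_{i,d}$ in this decomposition ($c_{i,d}=0$ if $\pi_{i,d}$ does not occur). Then $\overline{\beta}(\mathcal{O}_C,A_d)$ converges to the pure diagram $\pi_{g,d}$ in the sense that, as $d\to\infty$, $$c_{i,d}\longrightarrow \begin{cases} 0 & \text{if } i\neq g,\\ 1 & \text{if } i=g,\end{cases}$$ for each $i\in\{0,1,\dots,g\}$.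
   Context: Set $r_d:=\dim_{\mathbf{k}} H^0(C,A_d)-1=\deg A_d-g$, so the complete linear series $|A_d|$ embeds $C\subseteq\mathbb{P}^{r_d}$. Let $R(C,A_d):=\bigoplus_{e\ge 0}H^0(C,eA_d)$, where $eA_d$ means $A_d^{\otimes e}$, viewed as a graded module over the polynomial ring $\operatorname{Sym}(H^0(C,A_d))$. Its graded Betti numbers are $$\beta_{p,q}(\mathcal{O}_C,A_d):=\dim_{\mathbf{k}}\operatorname{Tor}_p^{\operatorname{Sym}(H^0(C,A_d))}(R(C,A_d),\mathbf{k})_q,$$ and the graded Betti table $\beta(\mathcal{O}_C,A_d)$ is the vector with these coordinates in $\mathbf{V}=\bigoplus_{p=0}^{n}\bigoplus_{q\in\mathbb{Z}}\mathbb{Q}$ ($n$ large enough, e.g. $n=r_d+1$). Pure diagrams: for a strictly increasing integer sequence (degree sequence) $\mathbf{e}=(\mathbf{e}_0<\dots<\mathbf{e}_s)$, the associated pure diagram is, up to a positive rational scalar, the element of $\mathbf{V}$ whose $(p,q)$ entry is $\prod_{\ell\ne p}\frac{1}{|\mathbf{e}_\ell-\mathbf{e}_p|}$ if $0\le p\le s$ and $q=\mathbf{e}_p$, and $0$ otherwise. Degree sequences are partially ordered by: $(\mathbf{e}_0,\dots,\mathbf{e}_s)\le(\mathbf{e}'_0,\dots,\mathbf{e}'_{s'})$ iff $s\ge s'$ and $\mathbf{e}_k\le \mathbf{e}'_k$ for all $0\le k\le s'$. The Boij--Söderberg decomposition of a (rationally rescaled) graded Betti table is its unique expression as a positive rational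 combination of pure diagrams whose degree sequences form a chain. The diagrams $\pi_{i,d}$: for $i\in\{0,\dots,g\}$, let $$\mathbf{e}=\mathbf{e}(i,d)=(0,2,3,\dots,r_d-i,\,r_d-i+2,r_d-i+3,\dots,r_d+1)\in\mathbb{Z}^{r_d},$$ i.e. the increasing list of the elements of $\{0,1,\dots,r_d+1\}\setminus\{1,\,r_d-i+1\}$, indexed as $\mathbf{e}_0<\mathbf{e}_1<\dots<\mathbf{e}_{r_d-1}$. Then $\pi_{i,d}\in\mathbf{V}$ is defined by $$\beta_{p,q}(\pi_{i,d})=\begin{cases}(r_d-1)!\cdot\prod_{\ell\ne p}\frac{1}{|\mathbf{e}_\ell-\mathbf{e}_p|} & \text{if } 0\le p\le r_d-1 \text{ and } q=\mathbf{e}_p,\\ 0&\text{otherwise.}\end{cases}$$ The Boij--Söderberg decomposition of $\overline{\beta}(\mathcal{O}_C,A_d)$ involves only the diagrams $\pi_{0,d},\dots,\pi_{g,d}$, with coefficients $c_{i,d}\ge 0$ satisfying $\sum_i c_{i,d}=1$. *)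

(* Defs.v *)
From HB Require Import structures.
From mathcomp Require Import all_boot all_order all_algebra.
From mathcomp Require Import boolp classical_sets functions cardinality fsbigop.
From mathcomp Require Import mpoly.
Set Implicit Arguments. Unset Strict Implicit. Unset Printing Implicit Defensive.
Import Order.TTheory GRing.Theory Num.Theory.
Local Open Scope classical_set_scope.
Local Open Scope ring_scope.

(* [b] maps to a k-basis of U / W, for k-subspaces W <= U of a K-vector space
   V, where k acts through [iota]. *)
Definition is_basis (k K : fieldType) (iota : {rmorphism k -> K})
    (V : lmodType K) (U W : set V) (n : nat) (b : 'I_n -> V) : Prop :=
  (forall i, U (b i)) /\
  (forall v, U v ->
     exists! c : 'rV[k]_n, W (v - \sum_(i < n) iota (c ord0 i) *: b i)).

Definition has_dim (k K : fieldType) (iota : {rmorphism k -> K})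
    (V : lmodType K) (U W : set V) (n : nat) : Prop :=
  exists b : 'I_n -> V, is_basis iota U W b.

(* An integral closed subscheme X of P^N over k is the closure of its generic
   point, i.e. of a point (x_0 : ... : x_N) with coordinates in the function
   field K of X: the chart X \cap {X_i != 0} is Spec k[x_0/x_i, ..., x_N/x_i]
   for x_i != 0 (and is empty for x_i = 0), all these rings being subrings of
   K. *)
Record proj_scheme (k : fieldType) := ProjScheme {
  funfield : fieldType;
  scalars : {rmorphism k -> funfield};
  ambient : nat;
  generic : 'I_ambient.+1 -> funfield }.

Section ProjScheme.
Context {k : fieldType}.
Implicit Types X : proj_scheme k.

Definition chart X (i : 'I_(ambient X).+1) : set (funfield X) :=
  [set a | exists F : {mpoly k[(ambient X).+1]},
     a = mmap (scalars X) (fun j => generic j / generic i) F].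

Definition ideal_of (K : fieldType) (B J : set K) : Prop :=
  [/\ J `<=` B, J 0, forall a b, J a -> J b -> J (a + b)
    & forall a b, B a -> J b -> J (a * b)].

Definition maximal_ideal (K : fieldType) (B m : set K) : Prop :=
  [/\ ideal_of B m, ~ m 1
    & forall J, ideal_of B J -> m `<=` J -> ~ J 1 -> J `<=` m].

Definition localization (K : fieldType) (B m : set K) : set K :=
  [set f | exists a b, [/\ B a, B b, ~ m b & f = a / b]].

(* A closed point is identified with its local ring; as X is separated, distinct
   points have distinct local rings, and a point lying in several charts is
   counted once. *)
Record closed_point X := ClosedPoint {
  stalk : set (funfield X);
  stalkP : exists (i : 'I_(ambient X).+1) (m : set (funfield X)),
    [/\ generic i != 0, maximal_ideal (chart i) m
      & stalk = localization (chart i) m] }.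

HB.instance Definition _ X := gen_eqMixin (closed_point X).
HB.instance Definition _ X := gen_choiceMixin (closed_point X).

Definition stalk_unit X (P : closed_point X) : set (funfield X) :=
  [set f | stalk P f /\ exists2 h, stalk P h & f * h = 1].

Definition stalk_max X (P : closed_point X) : set (funfield X) :=
  stalk P `\` stalk_unit P.

Definition uniformizer X (P : closed_point X) (t : funfield X) : Prop :=
  stalk_max P = [set f | exists2 a, stalk P a & f = t * a].

Definition alg_independent X (m : nat) (f : 'I_m -> funfield X) : Prop :=
  forall F : {mpoly k[m]}, mmap (scalars X) f F = 0 -> F = 0.

(* K is generated by the ratios of the coordinates of the generic point, and has
   transcendence degree 1 over k. *)
Definition is_curve X : Prop :=
  [/\ forall z : funfield X, exists i a b,
        [/\ @generic _ X i != 0, chart i a, chart i b, b != 0 & z = a / b],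
      exists f : 'I_1 -> funfield X, alg_independent f
    & forall f : 'I_2 -> funfield X, ~ alg_independent f].

(* The local ring at a closed point of a curve has dimension 1, so it is regular
   iff its maximal ideal is principal. *)
Definition is_regular X : Prop :=
  forall P : closed_point X, exists t, uniformizer P t.

End ProjScheme.

(* X' is the base change of X along [j], when that base change is integral:
   K and k' are linearly disjoint over k in the function field K' of X' (that
   is, K (x)_k k' -> K' is injective), and X' has the same generic coordinates,
   so that its charts are the tensor products of those of X with k'. *)
Definition is_base_change (k k' : fieldType) (j : {rmorphism k -> k'})
    (X : proj_scheme k) (X' : proj_scheme k') : Prop :=
  exists u : {rmorphism funfield X -> funfield X'},
  [/\ forall c, u (scalars X c) = scalars X' (j c),
      forall (m : nat) (a : 'I_m -> funfield X) (b : 'I_m -> k'),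
        (forall c : 'I_m -> k, \sum_(i < m) j (c i) * b i = 0 ->
           forall i, c i = 0) ->
        \sum_(i < m) u (a i) * scalars X' (b i) = 0 -> forall i, a i = 0
    & exists e : ambient X = ambient X',
        forall i, u (generic i) =
          @generic _ X' (cast_ord (congr1 succn e) i)].

(* Smoothness is geometric regularity, and a regular noetherian scheme is
   connected iff it is integral; so X is a smooth geometrically connected curve
   iff, for every field extension k'/k, the base change of X to k' is an
   integral regular curve. *)
Definition smooth_geom_connected (k : fieldType) (X : proj_scheme k) : Prop :=
  forall (k' : fieldType) (j : {rmorphism k -> k'}),
  exists X' : proj_scheme k',
    [/\ is_base_change j X X', is_curve X' & is_regular X'].

Record smooth_proj_curve (k : fieldType) := SmoothProjCurve {
  curve_scheme :> proj_scheme k;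
  curve_dim1 : is_curve curve_scheme;
  curve_smooth : smooth_geom_connected curve_scheme }.

Section LineBundle.
Context {k : fieldType} (C : smooth_proj_curve k).

(* Every line bundle on C is isomorphic to an invertible subsheaf of the
   constant sheaf K; its stalk at P is [gen P * O_P], and it coincides with O
   away from finitely many points. *)
Record line_bundle := LineBundle {
  gen : closed_point C -> funfield C;
  gen_neq0 : forall P, gen P != 0;
  gen_finite : finite_set [set P | ~ stalk_unit P (gen P)] }.

(* H^0(C, L^{(x) e}) *)
Definition sections (L : line_bundle) (e : nat) : set (funfield C)^o :=
  [set f | forall P, exists2 a, stalk P a & f = gen L P ^+ e * a].

Definition h0 (L : line_bundle) : nat :=
  xget 0%N [set n | has_dim (scalars C) (sections L 1) [set 0] n].

(* The space H^1(C, O_C) is the cokernel of K -> \bigoplus_P K / O_P, by the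
   flasque resolution 0 -> O_C -> K -> \bigoplus_P K / O_P -> 0. *)
Definition has_genus (g : nat) : Prop :=
  has_dim (scalars C)
    [set a : closed_point C -> (funfield C)^o |
       finite_set [set P | ~ stalk P (a P)]]
    [set a : closed_point C -> (funfield C)^o |
       exists f : funfield C, forall P, stalk P (a P - f)]
    g.

Definition valuation (P : closed_point C) (f : funfield C) : int :=
  xget 0 [set n : int | exists t u,
    [/\ uniformizer P t, stalk_unit P u & f = t ^ n * u]].

(* the degree of the residue field of P over k *)
Definition point_degree (P : closed_point C) : nat :=
  xget 0%N [set n | has_dim (scalars C)
    (stalk P : set (funfield C)^o) (stalk_max P) n].

(* The sign: O(D) is generated at P by elements of valuation - D(P). *)
Definition degree (L : line_bundle) : int :=
  - \sum_(P \in [set: closed_point C])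
      valuation P (gen L P) * (point_degree P)%:Z.

(* R(C, L) is realised as the subring \bigoplus_e H^0(C, L^e) t^e of K[t]. *)
Definition section_ring (L : line_bundle) : set {poly funfield C} :=
  [set f : {poly funfield C} | forall e, sections L e f`_e].

Definition section_ring_piece (L : line_bundle) (a : int) :
    set {poly funfield C} :=
  match a with
  | Posz e => [set f | exists2 s, sections L e s & f = s *: 'X^e]
  | Negz _ => [set 0]
  end.

(* A basis [s] of H^0(C, L) identifies Sym(H^0(C, L)) with k[X_j], and X_j acts
   on R(C, L) as multiplication by s_j t. *)
Definition sym_act (N : nat) (s : 'I_N -> funfield C) (F : {mpoly k[N]}) :
    {poly funfield C} :=
  mmap (fun c => (scalars C c)%:P) (fun j => s j *: 'X) F.

(* Graded free resolutions of R(C, L) of finite length by finitely generated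
   modules over S = k[X_j]: the p-th module is \bigoplus_j S(- gdeg p j), an
   element of it is a row vector, and [fdiff p] maps the (p+1)-st module to the
   p-th one by right multiplication. *)
Record free_resolution (L : line_bundle) (N : nat) (s : 'I_N -> funfield C) :=
    FreeResolution {
  frank : nat -> nat;
  gdeg : forall p, 'I_(frank p) -> int;
  fdiff : forall p, 'M[{mpoly k[N]}]_(frank p.+1, frank p);
  faug : 'I_(frank 0) -> {poly funfield C};
  frank_finite : exists l, forall p, (l <= p)%N -> frank p = 0%N;
  fdiff_homog : forall p i j m, (fdiff p i j)@_m != 0 ->
    gdeg i = gdeg j + (mdeg m)%:Z;
  faug_homog : forall j, section_ring_piece L (gdeg j) (faug j);
  faug_surj : forall f, section_ring L f -> exists v : 'rV[{mpoly k[N]}]_(frank 0),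
    f = \sum_j sym_act s (v ord0 j) * faug j;
  fexact0 : forall v : 'rV[{mpoly k[N]}]_(frank 0),
    \sum_j sym_act s (v ord0 j) * faug j = 0 <-> exists w, v = w *m fdiff 0;
  fexact : forall p (v : 'rV[{mpoly k[N]}]_(frank p.+1)),
    v *m fdiff p = 0 <-> exists w, v = w *m fdiff p.+1 }.

Section Tor.
Context (L : line_bundle) (N : nat) (s : 'I_N -> funfield C).
Context (F : free_resolution L s).

(* the differential of F (x)_S k *)
Definition tor_diff (p : nat) := map_mx (mcoeff 0%MM) (fdiff F p).

(* (F_p (x)_S k)_q *)
Definition tor_piece (p : nat) (q : int) : set 'rV[k]_(frank F p) :=
  [set v : 'rV[k]_(frank F p) | forall j, gdeg j != q -> v ord0 j = 0].

Definition tor_cycles (p : nat) : set 'rV[k]_(frank F p) :=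
  match p return set 'rV[k]_(frank F p) with
  | 0 => setT
  | p'.+1 => [set v : 'rV[k]_(frank F p'.+1) | v *m tor_diff p' = 0]
  end.

Definition tor_boundaries (p : nat) (q : int) : set 'rV[k]_(frank F p) :=
  [set w *m tor_diff p | w in @tor_piece p.+1 q].

(* dim_k Tor_p^S(R(C, L), k)_q = b *)
Definition has_tor_dim (p : nat) (q : int) (b : nat) : Prop :=
  has_dim (idfun : {rmorphism k -> k})
    (@tor_piece p q `&` @tor_cycles p) (@tor_boundaries p q) b.
End Tor.

Definition is_betti_table (L : line_bundle) (beta : nat -> int -> nat) : Prop :=
  exists (s : 'I_(h0 L) -> funfield C) (F : free_resolution L s),
    is_basis (scalars C) (sections L 1) [set 0] (s : 'I_(h0 L) -> (funfield C)^o)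
    /\ forall p q, has_tor_dim F p q (beta p q).

End LineBundle.

Definition table := nat -> int -> rat.

(* The pure diagram of e = (e_0 < ... < e_s), normalised by the factor s!. *)
Definition pure_diagram (e : seq int) : table := fun p q =>
  if (p < size e)%N && (q == e`_p)
  then ((size e).-1)`!%:R
       * \prod_(0 <= l < size e | l != p) (`|e`_l - e`_p|%:~R)^-1
  else 0.

Definition degseq_le (e e' : seq int) : Prop :=
  (size e' <= size e)%N /\ (forall l, (l < size e')%N -> e`_l <= e'`_l).

(* The family may contain sequences that do not occur, with coefficient 0. *)
Definition BS_decomposition (m : nat) (T : table) (e : 'I_m -> seq int)
    (c : 'I_m -> rat) : Prop :=
  [/\ forall i, 0 <= c i,
      injective e,
      forall i, 0 < c i -> e i != [::] /\ sorted <%R (e i),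
      forall i j, 0 < c i -> 0 < c j ->
        degseq_le (e i) (e j) \/ degseq_le (e j) (e i)
    & forall p q, T p q = \sum_(i < m) c i * pure_diagram (e i) p q].

(* e(i, d), with r = r_d; it has r terms for i < r. *)
Definition pi_degseq (r i : nat) : seq int :=
  [seq j%:Z | j <- iota 0 r.+2 & (j != 1) && (j != r - i + 1)]%N.

Definition rat_cvg (u : nat -> rat) (l : rat) : Prop :=
  forall eps : rat, 0 < eps ->
    exists N, forall d, (N <= d)%N -> `|u d - l| < eps.

(* Main.v *)
From HB Require Import structures.
From mathcomp Require Import all_boot all_order all_algebra finmap.
From mathcomp Require Import boolp classical_sets functions cardinality fsbigop.
From mathcomp Require Import mpoly ring zify.
Require Import Defs.
Set Implicit Arguments. Unset Strict Implicit. Unset Printing Implicit Defensive.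
Import Order.TTheory GRing.Theory Num.Theory.
Local Open Scope classical_set_scope.
Local Open Scope ring_scope.

(** Write [r = h0 (A d) - 1] and [m = degree (A d)]. The entries (0,0) and (1,2) of
    [pi_(i,d)] are [(r + 1 - i) / (r (r + 1))] and [(r - 1 - i) / 2], so the
    corresponding Betti numbers determine [\sum_i c_i] and [\sum_i i c_i].
    Since only the [pi_(i,d)] occur, the Euler characteristics of the strands of
    a free resolution give [beta_(0,0) = dim H^0(O_C) = 1] and
    [beta_(1,2) = 'C(r + 2, 2) - dim H^0(2 A_d)]. For [m] large,
    [dim H^0(e A_d) = e m + 1 - g], whence [\sum_i c_i = 1] and
    [\sum_i (g - i) c_i = g (g - 1) / m], which tends to 0.

    Riemann-Roch in large degree is proved with adeles: adding a point [P] to a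
    divisor changes [h^0 - h^1] by [deg P]; the adeles are [A(D0) + K] for some
    [D0] because the genus is finite, and a nonzero section of [D - D0]
    transports this to every [D] of large degree. *)

(** * Dimensions of quotients of subspaces *)

(** The two entries suffice because they are the only positions of the [pi_(i,d)] in internal degree
    at most 2. An Euler characteristic does not see whether a resolution is minimal, so the Hilbert
    function in degrees 0 and 2 yields both Betti numbers from any finite free resolution. The
    weighted sum suffices because every [c_i] is nonnegative and g - i is at least 1 for i < g: each
    such [c_i] is bounded by the sum of the (g - i) [c_i]. With r = m - g the entry (0,0) says that
    the (r + 1 - i) [c_i] add up to r (r + 1) / m; subtracting r + 1 - g leaves g (g - 1) / m. The
    obstacle is geometric. A curve is a function field K with generic coordinates, and a point is a
    subring of K, so the usual finiteness theorems must be rebuilt. Finite residue fields and finite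
    orders of vanishing come from the algebraic dependence of any two elements of K. Finiteness of
    the zeros of a section is deduced afterwards from the degree formula, so the adelic definitions
    cannot presuppose it. *)

Section Dimension.
Context {k : fieldType}.
Implicit Types V : lmodType k.

Definition subspace V (U : set V) : Prop :=
  U 0 /\ forall a u v, U u -> U v -> U (a *: u + v).

(** The dimension of the image of U in V / W. W need not lie inside U, and no quotient space is
    formed. *)
Definition dimq V (U W : set V) (n : nat) : Prop :=
  exists b : 'I_n -> V, (forall i, U (b i)) /\
  (forall v, U v ->
     exists! c : 'rV[k]_n, W (v - \sum_(i < n) c ord0 i *: b i)).

Lemma subspace0 V (U : set V) : subspace U -> U 0. Proof. by case. Qed.

Lemma subspaceD V (U : set V) u v : subspace U -> U u -> U v -> U (u + v).
Proof. by case=> _ h Uu Uv; rewrite -[u]scale1r; exact: h. Qed.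

Lemma subspaceZ V (U : set V) a u : subspace U -> U u -> U (a *: u).
Proof. by case=> h0 h Uu; rewrite -[_ *: _]addr0; exact: h. Qed.

Lemma subspaceN V (U : set V) u : subspace U -> U u -> U (- u).
Proof. by move=> sU Uu; rewrite -scaleN1r; exact: subspaceZ. Qed.

Lemma subspaceB V (U : set V) u v : subspace U -> U u -> U v -> U (u - v).
Proof. by move=> sU Uu Uv; apply: subspaceD => //; exact: subspaceN. Qed.

Lemma subspace_sum V (U : set V) (I : Type) (r : seq I) (P : pred I)
    (F : I -> V) : subspace U -> (forall i, P i -> U (F i)) ->
  U (\sum_(i <- r | P i) F i).
Proof.
move=> sU h; apply: big_ind => //; first exact: subspace0.
by move=> x y; exact: subspaceD.
Qed.

Lemma subspaceBr V (U : set V) u v : subspace U -> U u -> U (u - v) -> U v.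
Proof.
by move=> sU Uu Uuv; rewrite -[v](subKr u); exact: subspaceB.
Qed.

Lemma subspaceBl V (U : set V) u v : subspace U -> U v -> U (u - v) -> U u.
Proof. by move=> sU Uv Uuv; rewrite -[u](subrK v); exact: subspaceD. Qed.

Lemma subspaceI V (U T : set V) : subspace U -> subspace T -> subspace (U `&` T).
Proof.
move=> [U0 hU] [T0 hT]; split=> // a u v [Uu Tu] [Uv Tv].
by split; [exact: hU|exact: hT].
Qed.

Lemma subspace_set0 V : subspace [set (0 : V)].
Proof. by split=> // a u v -> ->; rewrite /= scaler0 addr0. Qed.

Lemma linear_comb V V' (phi : V -> V') (lphi : linear phi) n (c : 'rV[k]_n)
    (b : 'I_n -> V) :
  phi (\sum_i c ord0 i *: b i) = \sum_i c ord0 i *: phi (b i).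
Proof.
pose phi' : {linear V -> V'} :=
  HB.pack phi (GRing.isLinear.Build k V V' *:%R phi lphi).
by rewrite -[phi]/(phi' : _ -> _) linear_sum; apply: eq_bigr => i _; rewrite linearZ.
Qed.

Lemma linear_sub V V' (phi : V -> V') (lphi : linear phi) u v :
  phi (u - v) = phi u - phi v.
Proof.
pose phi' : {linear V -> V'} :=
  HB.pack phi (GRing.isLinear.Build k V V' *:%R phi lphi).
by rewrite -[phi]/(phi' : _ -> _) linearB.
Qed.

Lemma subspace_preim V V' (phi : V -> V') (U : set V') :
  linear phi -> subspace U -> subspace [set v | U (phi v)].
Proof.
move=> lphi sU; split=> /=.
  rewrite -(subrr 0) (linear_sub lphi) subrr; exact: subspace0.
by move=> a u v Uu Uv; rewrite lphi; case: sU => _; exact.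
Qed.

Lemma subspace_img V V' (phi : V -> V') (U : set V) :
  linear phi -> subspace U -> subspace [set phi v | v in U].
Proof.
move=> lphi [U0 hU]; split=> /=.
  by exists 0 => //; rewrite -(subrr 0) (linear_sub lphi) subrr.
by move=> a _ _ [u Uu <-] [v Uv <-]; exists (a *: u + v); [exact: hU|rewrite lphi].
Qed.

Lemma dimq_eq V (U W W' : set V) n :
  subspace U -> (forall u, U u -> (W u <-> W' u)) -> dimq U W n -> dimq U W' n.
Proof.
move=> sU WW' [b [Ub hb]]; exists b; split=> // v Uv.
have Uc (c : 'rV[k]_n) : U (v - \sum_i c ord0 i *: b i).
  by apply: subspaceB => //; apply: subspace_sum => // i _; exact: subspaceZ.
have [c [Wc uc]] := hb v Uv; exists c; split; first exact/WW'.
by move=> c' /WW' h; apply: uc; exact: h.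
Qed.

(** The hypotheses say that [phi] induces an isomorphism from U / W to U' / W': the equivalence
    gives injectivity, the last condition surjectivity. *)
Lemma dimq_iso V V' (phi : V -> V') (U W : set V) (U' W' : set V') n :
  linear phi -> subspace U -> subspace W' ->
  (forall u, U u -> U' (phi u)) ->
  (forall u, U u -> (W u <-> W' (phi u))) ->
  (forall u', U' u' -> exists2 u, U u & W' (u' - phi u)) ->
  dimq U W n -> dimq U' W' n.
Proof.
move=> lphi sU sW' UU' WW' surj [b [Ub hb]].
exists (fun i => phi (b i)); split=> [i|v' Uv']; first exact: UU'.
have [v Uv W'v] := surj v' Uv'.
have Uc (c : 'rV[k]_n) : U (v - \sum_i c ord0 i *: b i).
  by apply: subspaceB => //; apply: subspace_sum => // i _; exact: subspaceZ.
have E (c : 'rV[k]_n) : W (v - \sum_i c ord0 i *: b i) <->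
    W' (v' - \sum_i c ord0 i *: phi (b i)).
  rewrite WW' // (linear_sub lphi) (linear_comb lphi).
  have -> : v' - \sum_i c ord0 i *: phi (b i) =
    (v' - phi v) + (phi v - \sum_i c ord0 i *: phi (b i)).
    by rewrite addrA subrK.
  split=> [h|h]; first exact: subspaceD.
  by rewrite -[_ - _](addKr (v' - phi v)); apply: subspaceD => //; exact: subspaceN.
have [c [Wc uc]] := hb v Uv; exists c; split; first exact/E.
by move=> c' /E; exact: uc.
Qed.

(** The same isomorphism read backwards: a basis of the target is lifted along [phi] by choice. *)
Lemma dimq_iso_inv V V' (phi : V -> V') (U W : set V) (U' W' : set V') n :
  linear phi -> subspace U -> subspace W' -> subspace U' ->
  (forall u, U u -> U' (phi u)) ->
  (forall u, U u -> (W u <-> W' (phi u))) ->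
  (forall u', U' u' -> exists2 u, U u & W' (u' - phi u)) ->
  dimq U' W' n -> dimq U W n.
Proof.
move=> lphi sU sW' sU' UU' WW' surj [b' [Ub' hb']].
have /choice [b hb] : forall i, exists u, U u /\ W' (b' i - phi u).
  by move=> i; have [u] := surj _ (Ub' i); exists u.
exists b; split=> [i|v Uv]; first by case: (hb i).
have Uc (c : 'rV[k]_n) : U (v - \sum_i c ord0 i *: b i).
  apply: subspaceB => //; apply: subspace_sum => // i _.
  by apply: subspaceZ => //; case: (hb i).
have E (c : 'rV[k]_n) : W (v - \sum_i c ord0 i *: b i) <->
    W' (phi v - \sum_i c ord0 i *: b' i).
  rewrite WW' // (linear_sub lphi) (linear_comb lphi).
  have -> : phi v - \sum_i c ord0 i *: phi (b i) =
     (phi v - \sum_i c ord0 i *: b' i) + \sum_i c ord0 i *: (b' i - phi (b i)).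
    under [X in _ = _ + X]eq_bigr => i _ do rewrite scalerBr.
    by rewrite sumrB addrA subrK.
  have h : W' (\sum_i c ord0 i *: (b' i - phi (b i))).
    by apply: subspace_sum => // i _; apply: subspaceZ => //; case: (hb i).
  split=> [h'|h']; last exact: subspaceD.
  by rewrite -[_ - _](addrK (\sum_i c ord0 i *: (b' i - phi (b i)))); exact: subspaceB.
have [c [Wc uc]] := hb' _ (UU' _ Uv); exists c; split; first exact/E.
by move=> c' /E; exact: uc.
Qed.

(** The matrix expressing the first basis in the second has independent rows, since a relation among
    them would represent 0 modulo W in two ways. *)
Lemma dimq_le V (U W : set V) n m : subspace U ->
  subspace W -> dimq U W n -> dimq U W m -> (n <= m)%N.
Proof.
move=> sU sW [b [Ub hb]] [b' [Ub' hb']].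
have /choice [M hM] : forall i, exists c : 'rV[k]_m,
    W (b i - \sum_(j < m) c ord0 j *: b' j).
  by move=> i; have [c [? _]] := hb' _ (Ub i); exists c.
pose A := \matrix_(i < n) M i.
suff : row_free A by rewrite /row_free => /eqP <-; exact: rank_leq_col.
apply/inj_row_free => c cA0.
have W0 : W (0 - \sum_i c ord0 i *: b i).
  rewrite sub0r; apply: subspaceN => //.
  have -> : \sum_i c ord0 i *: b i =
      \sum_i c ord0 i *: (b i - \sum_(j < m) A i j *: b' j).
    under [RHS]eq_bigr => i _ do rewrite scalerBr scaler_sumr.
    rewrite sumrB exchange_big /=.
    rewrite [X in _ - X]big1 ?subr0 // => j _.
    under eq_bigr do rewrite scalerA.
    rewrite -scaler_suml.
    move/matrixP: cA0 => /(_ ord0 j); rewrite !mxE => ->.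
    by rewrite scale0r.
  apply: subspace_sum => // i _; apply: subspaceZ => //.
  rewrite (_ : \sum_(j < m) _ = \sum_(j < m) M i ord0 j *: b' j) //.
  by apply: eq_bigr => j _; rewrite mxE.
have W0' : W (0 - \sum_i (0 : 'rV_n) ord0 i *: b i).
  rewrite big1 ?subr0; first exact: subspace0.
  by move=> i _; rewrite mxE scale0r.
have [c0 [_ uc]] := hb 0 (subspace0 sU).
by rewrite -(uc _ W0) -(uc _ W0').
Qed.

Lemma dimq_inj V (U W : set V) n m : subspace U -> subspace W ->
  dimq U W n -> dimq U W m -> n = m.
Proof.
by move=> sU sW Un Um; apply/eqP; rewrite eqn_leq !(dimq_le sU sW).
Qed.

Lemma dimq_add V (U T W : set V) a b :
  subspace U -> subspace T -> subspace W -> W `<=` T -> T `<=` U ->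
  dimq T W a -> dimq U T b -> dimq U W (a + b).
Proof.
move=> sU sT sW WT TU [x [Tx hx]] [y [Uy hy]].
exists (fun i => match fintype.split i with inl i => x i | inr i => y i end); split.
  by move=> i; case: (fintype.split i) => j; [exact/TU|].
have E (c : 'rV[k]_(a + b)) : \sum_i c ord0 i *:
    match fintype.split i with inl i => x i | inr i => y i end =
    \sum_i lsubmx c ord0 i *: x i + \sum_i rsubmx c ord0 i *: y i.
  rewrite big_split_ord /=; congr (_ + _); apply: eq_bigr => i _.
    by rewrite mxE (unsplitK (inl i)).
  by rewrite mxE (unsplitK (inr i)).
move=> v Uv; have [c2 [Tc2 u2]] := hy v Uv; have [c1 [Wc1 u1]] := hx _ Tc2.
exists (row_mx c1 c2); split=> [|c Wc].
  by rewrite E row_mxKl row_mxKr opprD [- _ + _]addrC addrA.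
rewrite -[c]hsubmxK; rewrite E in Wc.
have Tl : T (\sum_i lsubmx c ord0 i *: x i).
  by apply: subspace_sum => // i _; exact: subspaceZ.
have e2 : c2 = rsubmx c.
  apply: u2; apply: (subspaceBl sT Tl); apply: WT.
  by rewrite -addrA -opprD [X in _ - X]addrC.
congr row_mx => //; apply: u1; rewrite e2.
by rewrite -addrA -opprD [X in _ - X]addrC.
Qed.

(** Among the matrices with row space inside T take one of maximal rank: adjoining a vector of T
    cannot raise the rank, so the vector was already in the row space. *)
Lemma rV_subspace n (T : set 'rV[k]_n) : subspace T ->
  exists M : 'M[k]_n, forall v, T v <-> (v <= M)%MS.
Proof.
move=> sT.
pose Q r := `[< exists2 M : 'M[k]_n, (forall v, (v <= M)%MS -> T v) & \rank M = r >].
have exQ : exists r, Q r.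
  exists 0%N; apply/asboolP; exists 0; last exact: mxrank0.
  by move=> v /submx0null ->; exact: subspace0.
have ubQ r : Q r -> (r <= n)%N by move=> /asboolP [M _ <-]; exact: rank_leq_row.
case: (ex_maxnP exQ ubQ) => r /asboolP [M MT rM] maxr.
exists M => v; split=> [Tv|]; last exact: MT.
have : Q (\rank (M + v)%MS).
  apply/asboolP; exists (M + v)%MS => // w /sub_addsmxP [[a b] /= ->].
  apply: subspaceD => //; first by apply: MT; exact: submxMl.
  have -> : b *m v = b ord0 ord0 *: v.
    by rewrite [b in LHS]mx11_scalar mul_scalar_mx.
  exact: subspaceZ.
move=> /maxr; rewrite -rM => h.
have [_ e] := mxrank_leqif_eq (addsmxSl M v).
have /andP [_ sub] : (M == M + v)%MS.
  by rewrite -e eqn_leq h mxrankS ?addsmxSl.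
exact: submx_trans (addsmxSr M v) sub.
Qed.

Lemma dimq_rowspace m n (M : 'M[k]_(m, n)) :
  dimq [set v : 'rV[k]_n | (v <= M)%MS] [set 0] (\rank M).
Proof.
exists (fun i => row i (row_base M)); split=> [i /=|v /= vM].
  by rewrite -(eq_row_base M) row_sub.
have := vM; rewrite -(eq_row_base M) => /submxP [c ec].
have E (c' : 'rV_(\rank M)) :
    \sum_i c' ord0 i *: row i (row_base M) = c' *m row_base M.
  by rewrite mulmx_sum_row.
exists c; split=> [|c']; first by rewrite /= E -ec subrr.
rewrite /= E ec => /subr0_eq.
exact: (row_free_inj (row_base_free M)).
Qed.

Lemma dimq_rV n (T : set 'rV[k]_n) : subspace T ->
  exists a b, [/\ dimq T [set 0] a, dimq [set: 'rV[k]_n] T b & (a + b = n)%N].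
Proof.
move=> sT; have [M hM] := rV_subspace sT.
exists (\rank M), (\rank (M^C)%MS); split.
- have -> : T = [set v : 'rV[k]_n | (v <= M)%MS].
    by apply/seteqP; split=> v /hM.
  exact: dimq_rowspace.
- apply: (dimq_iso (phi := id)) (dimq_rowspace (M^C)%MS) => //.
  + split=> /=; first exact: sub0mx.
    by move=> a u v hu hv; rewrite addmx_sub // scalemx_sub.
  + move=> u /= uC; split=> [->|/hM uM]; first exact: subspace0.
    by apply/eqP; rewrite -submx0 -(capmx_compl M) sub_capmx uM.
  + move=> v _; have : (v <= M + M^C)%MS.
      by rewrite (submx_trans (submx1 v)) // sub1mx addsmx_compl_full.
    move=> /sub_addsmxP [[a b] /= ->]; exists (b *m M^C)%MS; first exact: submxMl.
    by apply/hM; rewrite /= addrK submxMl.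
- by rewrite mxrank_compl subnKC // rank_leq_col.
Qed.

(** U / W is the quotient of the coordinate space by the preimage of W, where matrix rank provides
    dimensions. *)
Lemma dimq_span V (U W : set V) n (b : 'I_n -> V) :
  subspace U -> subspace W -> (forall i, U (b i)) ->
  (forall v, U v -> exists c : 'rV[k]_n, W (v - \sum_i c ord0 i *: b i)) ->
  exists2 m, (m <= n)%N & dimq U W m.
Proof.
move=> sU sW Ub hb.
pose psi (c : 'rV[k]_n) := \sum_i c ord0 i *: b i.
have lpsi : linear psi.
  move=> a u v; rewrite /psi scaler_sumr -big_split /=.
  by apply: eq_bigr => i _; rewrite !mxE scalerDl scalerA.
have [x [y [_ hy e]]] := dimq_rV (subspace_preim lpsi sW).
exists y; first by rewrite -e leq_addl.
apply: (dimq_iso lpsi) hy => //.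
- by move=> u _; apply: subspace_sum => // i _; exact: subspaceZ.
- by move=> u /hb [c]; exists c.
Qed.

(** Produces the dimensions of T / W and U / T instead of assuming them: T is pulled back to the
    coordinate space of U / W and split off there. *)
Lemma dimq_split V (U T W : set V) n :
  subspace U -> subspace T -> subspace W -> W `<=` T -> T `<=` U ->
  dimq U W n ->
  exists a b, [/\ dimq T W a, dimq U T b & (a + b = n)%N].
Proof.
move=> sU sT sW WT TU [x [Ux hx]].
pose psi (c : 'rV[k]_n) := \sum_i c ord0 i *: x i.
have lpsi : linear psi.
  move=> a u v; rewrite /psi scaler_sumr -big_split /=.
  by apply: eq_bigr => i _; rewrite !mxE scalerDl scalerA.
have Upsi (c : 'rV[k]_n) : U (psi c) by apply: subspace_sum => // i _; exact: subspaceZ.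
have [a [b [ha hb e]]] := dimq_rV (subspace_preim lpsi sT).
exists a, b; split=> //.
- apply: (dimq_iso lpsi) ha => //; first exact: subspace_preim.
  + move=> c Tc; split=> [->|Wc].
      by rewrite /psi big1 ?subspace0 //; [exact: subspace0|move=> i _; rewrite mxE scale0r].
    have [c0 [_ uc]] := hx 0 (subspace0 sU).
    rewrite -(uc c); last by rewrite sub0r; exact: subspaceN.
    rewrite -(uc 0) // sub0r big1 ?oppr0; first exact: subspace0.
    by move=> i _; rewrite mxE scale0r.
  + move=> v Tv; have [c [Wc _]] := hx v (TU _ Tv); exists c => //=.
    by apply: (subspaceBr sT Tv); exact: WT.
- apply: (dimq_iso lpsi) hb => //.
  by move=> v /hx [c [Wc _]]; exists c => //; exact: WT.
Qed.

Lemma dimq_sub V (U T W : set V) n m :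
  subspace U -> subspace T -> subspace W -> W `<=` T -> T `<=` U ->
  dimq U W n -> dimq T W m -> (m <= n)%N.
Proof.
move=> sU sT sW WT TU Un Tm.
have [a [b [Ta _ <-]]] := dimq_split sU sT sW WT TU Un.
by rewrite (dimq_inj sT sW Tm Ta) leq_addr.
Qed.

Lemma dimq_image V V' (phi : V -> V') (U : set V) n :
  linear phi -> subspace U -> dimq U [set 0] n ->
  exists a b, [/\ dimq (U `&` [set v | phi v = 0]) [set 0] a,
    dimq [set phi v | v in U] [set 0] b & (a + b = n)%N].
Proof.
move=> lphi sU Un.
have sK : subspace (U `&` [set v | phi v = 0]).
  apply: subspaceI => //.
  exact: (subspace_preim lphi (subspace_set0 V')).
have [a [b [ha hb e]]] := dimq_split sU sK (subspace_set0 V)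
  (fun _ h => eq_ind_r _ (subspace0 sK) h) (fun _ h => h.1) Un.
exists a, b; split=> //.
apply: (dimq_iso lphi) hb => //; first exact: subspace_set0.
- by move=> u Uu; exists u.
- by move=> u Uu; split=> [[]|] //.
- by move=> _ [u Uu <-]; exists u => //; rewrite /= subrr.
Qed.

Lemma dimq0 V (U : set V) : U `<=` [set 0] -> dimq U [set 0] 0.
Proof.
move=> U0; exists (fun=> 0); split=> [[]|v /U0 ->] //.
exists 0; split=> [|c _]; first by rewrite big_ord0 subr0.
by apply/rowP => -[].
Qed.

Lemma dimq_pos V (U W : set V) n v : U v -> ~ W v -> dimq U W n -> (0 < n)%N.
Proof.
case: n => // Uv nWv [b [_ /(_ v Uv) [c [+ _]]]].
by rewrite big_ord0 subr0.
Qed.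

Lemma dimq_dep V (U : set V) n (u : nat -> V) :
  dimq U [set 0] n -> (forall i, U (u i)) ->
  exists2 c : 'rV[k]_n.+1, c != 0 & \sum_i c ord0 i *: u i = 0.
Proof.
move=> [b [Ub hb]] Uu.
have /choice [M hM] : forall i, exists c : 'rV[k]_n,
    u i = \sum_(j < n) c ord0 j *: b j.
  by move=> i; have [c [/subr0_eq ? _]] := hb _ (Uu i); exists c.
pose A := \matrix_(i < n.+1) M i.
have : ~~ row_free A by rewrite /row_free neq_ltn ltnS rank_leq_col.
rewrite -kermx_eq0 => /rowV0Pn [c /sub_kermxP cA0 c0]; exists c => //.
under eq_bigr => i _ do rewrite hM scaler_sumr.
rewrite exchange_big big1 // => j _ /=.
under eq_bigr do rewrite scalerA.
rewrite -scaler_suml; move/matrixP: cA0 => /(_ ord0 j); rewrite !mxE.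
by under eq_bigr do rewrite mxE; move=> ->; rewrite scale0r.
Qed.

End Dimension.

(** * Restriction of scalars *)

Definition restr (k : fieldType) (K : nzRingType) (iota : {rmorphism k -> K})
  (V : lmodType K) : Type := V.

Section Restr.
Context (k : fieldType) (K : nzRingType) (iota : {rmorphism k -> K}).
Context (V : lmodType K).

HB.instance Definition _ := GRing.Zmodule.on (restr iota V).

Definition restr_scale (a : k) (v : restr iota V) : restr iota V :=
  iota a *: (v : V).

Fact restr_scalerA a b v :
  restr_scale a (restr_scale b v) = restr_scale (a * b) v.
Proof. by rewrite /restr_scale scalerA rmorphM. Qed.
Fact restr_scale1r : left_id 1 restr_scale.
Proof. by move=> v; rewrite /restr_scale rmorph1 scale1r. Qed.
Fact restr_scalerDr : right_distributive restr_scale +%R.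
Proof. by move=> a u v; rewrite /restr_scale scalerDr. Qed.
Fact restr_scalerDl v : {morph restr_scale^~ v : a b / a + b}.
Proof. by move=> a b; rewrite /restr_scale rmorphD scalerDl. Qed.

HB.instance Definition _ := GRing.Zmodule_isLmodule.Build k (restr iota V)
  restr_scalerA restr_scale1r restr_scalerDr restr_scalerDl.

Lemma restr_scaleE (a : k) (v : restr iota V) :
  a *: v = iota a *: (v : V) :> V.
Proof. by []. Qed.

End Restr.

(** Holds by conversion, because [restr] changes nothing but the scalar action. *)
Lemma has_dimE (k K : fieldType) (iota : {rmorphism k -> K}) (V : lmodType K)
    (U W : set V) n :
  has_dim iota U W n = dimq (U : set (restr iota V)) W n.
Proof. by []. Qed.

(** * Polynomial relations in extensions of transcendence degree one *)

Lemma rmorph_mmap (R : nzRingType) (S T : comNzRingType) (n : nat)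
    (phi : {rmorphism S -> T}) (f : R -> S) (h : 'I_n -> S) (p : {mpoly R[n]}) :
  phi (mmap f h p) = mmap (phi \o f) (phi \o h) p.
Proof.
rewrite /mmap rmorph_sum; apply: eq_bigr => m _; rewrite rmorphM rmorph_prod.
by congr (_ * _); apply: eq_bigr => i _; rewrite rmorphXn.
Qed.

Lemma eq_mmap (R : nzRingType) (S : comNzRingType) (n : nat)
    (f g : R -> S) (h h' : 'I_n -> S) (p : {mpoly R[n]}) :
  f =1 g -> h =1 h' -> mmap f h p = mmap g h' p.
Proof.
move=> fg hh'; rewrite /mmap; apply: eq_bigr => m _; rewrite fg.
by congr (_ * _); exact: mmap1_eq.
Qed.

Lemma mmap_idE (R : comNzRingType) (n : nat) (p : {mpoly R[n]}) :
  mmap (@mpolyC n R) (fun i => 'X_i) p = p.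
Proof.
rewrite [RHS]mpolyE /mmap; apply: eq_bigr => m _.
by rewrite mmap1_id mul_mpolyC.
Qed.

Section Evaluation.
Context {R S : comNzRingType} (iota : {rmorphism R -> S}).

Definition evp (x : S) : {poly R} -> S :=
  horner_morph (fun a => mulrC x (iota a)).
HB.instance Definition _ x := GRing.RMorphism.on (evp x).

Lemma evpC x c : evp x c%:P = iota c.
Proof. by rewrite /evp /horner_morph map_polyC hornerC. Qed.
Lemma evpX x : evp x 'X = x.
Proof. by rewrite /evp /horner_morph map_polyX hornerX. Qed.
Lemma evpE x p : evp x p = \sum_(i < size p) iota p`_i * x ^+ i.
Proof.
rewrite /evp /horner_morph (@horner_coef_wide _ (size p)) ?size_poly //.
by apply: eq_bigr => i _; rewrite coef_map.
Qed.
End Evaluation.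

Section Evaluation2.
Context {R S : comNzRingType} (iota : {rmorphism R -> S}).
(** The inner variable stands for x, the outer one for y. *)
Definition ev2 (x y : S) : {poly {poly R}} -> S := evp (evp iota x) y.
HB.instance Definition _ x y := GRing.RMorphism.on (ev2 x y).

Lemma ev2MXaddC x y F c : ev2 x y (F * 'X + c%:P) = ev2 x y F * y + evp iota x c.
Proof. by rewrite rmorphD rmorphM /= /ev2 evpX evpC. Qed.
End Evaluation2.

Section Dependence.
Context {k K : fieldType} (iota : {rmorphism k -> K}).

Definition subalg (B : set K) : Prop :=
  [/\ forall c, B (iota c), forall a b, B a -> B b -> B (a + b)
    & forall a b, B a -> B b -> B (a * b)].

Section SubalgTheory.
Variables (B : set K) (sB : subalg B).

Lemma subalgC c : B (iota c). Proof. by case: sB. Qed.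
Lemma subalgD a b : B a -> B b -> B (a + b). Proof. by case: sB => _ + _; exact. Qed.
Lemma subalgM a b : B a -> B b -> B (a * b). Proof. by case: sB => _ _; exact. Qed.
Lemma subalg0 : B 0. Proof. by rewrite -(rmorph0 iota); exact: subalgC. Qed.
Lemma subalg1 : B 1. Proof. by rewrite -(rmorph1 iota); exact: subalgC. Qed.
Lemma subalgN a : B a -> B (- a).
Proof.
by move=> Ba; rewrite -mulN1r -(rmorph1 iota) -rmorphN; apply: subalgM; [exact: subalgC|].
Qed.
Lemma subalgB a b : B a -> B b -> B (a - b).
Proof. by move=> Ba Bb; apply: subalgD => //; exact: subalgN. Qed.
Lemma subalgX a n : B a -> B (a ^+ n).
Proof.
move=> Ba; elim: n => [|n IHn]; first exact: subalg1.
by rewrite exprS; exact: subalgM.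
Qed.
Lemma subalg_sum I (r : seq I) (P : pred I) F :
  (forall i, P i -> B (F i)) -> B (\sum_(i <- r | P i) F i).
Proof. by move=> h; apply: big_ind => //; [exact: subalg0|exact: subalgD]. Qed.
Lemma subalg_prod I (r : seq I) (P : pred I) F :
  (forall i, P i -> B (F i)) -> B (\prod_(i <- r | P i) F i).
Proof. by move=> h; apply: big_ind => //; [exact: subalg1|exact: subalgM]. Qed.
Lemma subalg_mmap n (y : 'I_n -> K) F : (forall j, B (y j)) -> B (mmap iota y F).
Proof.
move=> By; apply: subalg_sum => m _; apply: subalgM; first exact: subalgC.
by apply: subalg_prod => i _; exact: subalgX.
Qed.
Lemma subalg_evp x p : B x -> B (evp iota x p).
Proof.
move=> Bx; elim/poly_ind: p => [|p c IHp]; first by rewrite rmorph0; exact: subalg0.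
rewrite rmorphD rmorphM /= evpX evpC.
by apply: subalgD; [exact: subalgM|exact: subalgC].
Qed.
Lemma subalg_ev2 x y F : B x -> B y -> B (ev2 iota x y F).
Proof.
move=> Bx By; elim/poly_ind: F => [|F c IHF]; first by rewrite rmorph0; exact: subalg0.
by rewrite ev2MXaddC; apply: subalgD; [exact: subalgM|exact: subalg_evp].
Qed.

(* The lowest nonzero coefficient of F, evaluated at x, is divisible by y. *)
Lemma ev2_root_dvd x y F : B x -> B y -> y != 0 -> F != 0 -> ev2 iota x y F = 0 ->
  exists p b, [/\ p != 0, B b & evp iota x p = y * b].
Proof.
move=> Bx By y0; elim/poly_ind: F => [|F c IHF]; first by rewrite eqxx.
have [->|c0 _] := eqVneq c 0.
  rewrite addr0 => F0; have {}F0 : F != 0 by apply: contraNneq F0 => ->; rewrite mul0r.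
  rewrite -[_ * 'X]addr0 -polyC0 ev2MXaddC rmorph0 addr0 => /eqP.
  by rewrite mulf_eq0 (negbTE y0) orbF => /eqP; exact: IHF.
rewrite ev2MXaddC => /eqP; rewrite addr_eq0 => /eqP e.
exists c, (- ev2 iota x y F); split=> //; first by apply: subalgN; exact: subalg_ev2.
by rewrite mulrN mulrC e opprK.
Qed.
End SubalgTheory.

Lemma mmap_rel2 (f : 'I_2 -> K) (F : {mpoly k[2]}) : F != 0 -> mmap iota f F = 0 ->
  exists2 G : {poly {poly k}}, G != 0 & ev2 iota (f ord0) (f ord_max) G = 0.
Proof.
move=> F0 fF.
have or2 (i : 'I_2) : i = ord0 \/ i = ord_max.
  by case: i => [[|[|i]] hi] //; [left|right]; apply: val_inj.
pose G := mmap (@polyC {poly k} \o @polyC k)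
  (fun i : 'I_2 => if i == ord0 then 'X%:P else 'X) F.
exists G; last first.
  rewrite -[RHS]fF rmorph_mmap; apply: eq_mmap => [c|i] /=.
    by rewrite /ev2 evpC /= evpC.
  by have [->|->] := or2 i; rewrite /ev2 /= ?evpC /= evpX.
(* Sending the two variables back to ['X_ord0] and ['X_ord_max] turns G into F, so G = 0 would force
   F = 0. *)
apply: contraNneq F0 => G0; apply/eqP.
rewrite -[F]mmap_idE -(rmorph0 (ev2 (@mpolyC 2 k) 'X_ord0 'X_ord_max)) -G0 rmorph_mmap.
apply: eq_mmap => [c|i] /=; first by rewrite /ev2 evpC /= evpC.
by have [->|->] := or2 i; rewrite /ev2 /= ?evpC /= evpX.
Qed.

(** Transcendence degree at most one. *)
Definition algdep2 : Prop := forall x y : K,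
  exists2 G : {poly {poly k}}, G != 0 & ev2 iota x y G = 0.

Definition transc (x : K) : Prop := forall p : {poly k}, evp iota x p = 0 -> p = 0.

(** If G has degree n + 1 in y and leading coefficient c, then c^n G(y) = 0 is a monic equation for
    c y over k[x]. *)
Lemma integral_lead x y G : transc x -> G != 0 -> ev2 iota x y G = 0 ->
  integralOver (evp iota x) (evp iota x (lead_coef G) * y).
Proof.
move=> tx G0 Gy; set c := lead_coef G.
(* A relation constant in y would be a polynomial relation for x alone. *)
have [n sG] : exists n, size G = n.+2.
  have : (1 < size G)%N.
    rewrite ltnNge; apply/negP => /size1_polyC e.
    by move: Gy G0; rewrite e /ev2 evpC => /tx ->; rewrite eqxx.
  by case: (size G) => [|[|n]] // _; exists n.
pose q := \poly_(i < n.+2) (if i == n.+1 then 1 else G`_i * c ^+ (n - i)).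
have sq : size q = n.+2 by rewrite size_poly_eq //= eqxx oner_neq0.
exists q.
  by rewrite monicE lead_coefE sq /= coef_poly ltnSn eqxx.
have Ec : c = G`_n.+1 by rewrite /c lead_coefE sG.
rewrite /root -[_.[_]]/(evp (evp iota x) _ q) evpE sq.
have : evp iota x c ^+ n * ev2 iota x y G = 0 by rewrite Gy mulr0.
rewrite /ev2 [evp _ y G]evpE sG mulr_sumr => h.
apply/eqP; rewrite -[RHS]h; apply: eq_bigr => i _.
rewrite coef_poly ltn_ord exprMn.
have [->|ni] := eqVneq (val i) n.+1.
  by rewrite rmorph1 mul1r -Ec exprSr; ring.
have li : (i <= n)%N by have := ltn_ord i; rewrite ltnS leq_eqVlt (negbTE ni).
rewrite rmorphM rmorphXn /=.
rewrite (_ : evp iota x c ^+ n = evp iota x c ^+ (n - i) * evp iota x c ^+ i).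
  ring.
by rewrite -exprD subnK.
Qed.

(* Zariski's lemma in transcendence degree one: after multiplication by powers
   of some c in k[x], all of k[y] becomes integral over k[x]; but no c^M / q
   with q = 1 + x c is. *)
Lemma fg_algebra_not_field n (y : 'I_n -> K) (x : K) : algdep2 -> transc x ->
  exists z : K, forall F : {mpoly k[n]}, z <> mmap iota y F.
Proof.
move=> dep tx.
have /choice [G hG] : forall j, exists G, G != 0 /\ ev2 iota x (y j) G = 0.
  by move=> j; have [G] := dep x (y j); exists G.
pose c := \prod_j lead_coef (G j).
have c0 : c != 0.
  by apply/prodf_neq0 => j _; rewrite lead_coef_eq0; case: (hG j).
pose e : {rmorphism {poly k} -> K} := evp iota x; pose int z := integralOver e z.
pose B := [set z | exists M, int (e c ^+ M * z)].
have intX z M : int z -> int (z ^+ M).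
  move=> iz; elim: M => [|M IH]; first exact: integral1.
  by rewrite exprS; exact: integral_mul.
have inte p : int (e p) by exact: integral_id.
have sB : subalg B.
  split=> [a|a b [M ha] [N hb]|a b [M ha] [N hb]].
  - by exists 0%N; rewrite mul1r -(evpC iota x a); exact: inte.
  - exists (M + N)%N; rewrite mulrDr; apply: integral_add.
      rewrite exprD (_ : _ * _ * _ = e c ^+ N * (e c ^+ M * a)); last by ring.
      by apply: integral_mul => //; exact: intX.
    rewrite exprD -mulrA.
    by apply: integral_mul => //; exact: intX.
  - exists (M + N)%N.
    rewrite exprD (_ : _ * _ * _ = (e c ^+ M * a) * (e c ^+ N * b)); last by ring.
    exact: integral_mul.
have By j : B (y j).
  exists 1%N; rewrite expr1 /c (bigD1 j) //= rmorphM /= mulrAC.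
  apply: integral_mul; last exact: inte.
  by have [? ?] := hG j; exact: integral_lead.
(* This polynomial is nonconstant and coprime to c, so it divides no power of c. *)
pose q := 1 + 'X * c.
have sq : size q = (size c).+1.
  rewrite /q addrC size_polyDl mulrC size_mulX // size_poly1 ltnS.
  by rewrite lt0n size_poly_eq0.
have q0 : e q != 0.
  apply/eqP => /tx q0; move: sq; rewrite q0 size_poly0 //.
exists (e q)^-1 => F eF.
have [M [p pm]] : B (e q)^-1 by rewrite eF; exact: subalg_mmap.
rewrite /root -[_.[_]]/(evp e _ p) evpE => /eqP.
have [n' sp] : exists n', size p = n'.+1.
  by exists (size p).-1; rewrite prednK // lt0n size_poly_eq0 monic_neq0.
rewrite sp => h.
(* Clearing denominators in p(c^M / q) = 0 gives an identity in k[x], in which every term except the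
   leading one c^(M n') has a factor q. *)
have : e (\sum_(i < n'.+1) p`_i * c ^+ (M * i) * q ^+ (n' - i)) = 0.
  have := congr1 (fun u => e q ^+ n' * u) h; rewrite mulr0 => <-.
  rewrite rmorph_sum mulr_sumr; apply: eq_bigr => i _.
  rewrite !rmorphM !rmorphXn /= exprMn exprVn -exprM.
  rewrite (_ : e q ^+ n' = e q ^+ (n' - i) * e q ^+ i).
    by field; rewrite expf_neq0.
  by rewrite -exprD subnK // -ltnS.
move=> /tx; rewrite big_ord_recr /= subnn expr0 mulr1.
have -> : p`_n' = 1 by move: pm; rewrite monicE lead_coefE sp => /eqP.
rewrite mul1r => /eqP; rewrite addrC addr_eq0 => /eqP e1.
have : q %| c ^+ (M * n').
  rewrite e1 dvdpNr; apply: (big_ind (fun u => q %| u)) => [|u v|i _].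
  - exact: dvdp0.
  - exact: dvdp_add.
  - by apply: dvdp_mull; rewrite -subnSK // exprS dvdp_mulr.
have cop : coprimep q c.
  apply/coprimepP => d dq dc.
  have : d %| q - 'X * c by rewrite dvdp_sub // dvdp_mull.
  by rewrite /q addrK dvdp1 size_poly_eq1.
rewrite -[c ^+ _]mul1r Gauss_dvdpl; last exact: coprimep_expr.
by rewrite dvdp1 sq eqSS size_poly_eq0 (negbTE c0).
Qed.
End Dependence.

(** * Local rings of a regular curve *)

Section MaximalIdeals.
Context {k K : fieldType} (iota : {rmorphism k -> K}) (B : set K).
Hypothesis sB : subalg iota B.

Lemma ideal0 J : ideal_of B J -> J 0. Proof. by case. Qed.
Lemma idealD J a b : ideal_of B J -> J a -> J b -> J (a + b).
Proof. by case=> _ _ + _; exact. Qed.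
Lemma idealMl J a b : ideal_of B J -> B a -> J b -> J (a * b).
Proof. by case=> _ _ _; exact. Qed.
(** The ideal J = m + bB is strictly larger than m, so by maximality it contains 1. *)
Lemma maximal_ideal_inv m b : maximal_ideal B m -> B b -> ~ m b ->
  exists2 x, B x & m (1 - b * x).
Proof.
move=> [im m1 mmax] Bb nmb.
pose J := [set z | exists2 x, B x & m (z - b * x)].
have mB : m `<=` B by case: im.
have mJ : m `<=` J.
  by move=> z mz; exists 0; [exact: (subalg0 sB)|rewrite mulr0 subr0].
have iJ : ideal_of B J.
  split=> [z [x Bx mz]||z z' [x Bx mz] [x' Bx' mz']|a z Ba [x Bx mz]].
  - rewrite -[z](subrK (b * x)); apply: (subalgD sB); first exact: mB.
    exact: (subalgM sB).
  - by apply: mJ; exact: ideal0 im.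
  - exists (x + x'); first exact: (subalgD sB).
    by rewrite mulrDr opprD addrACA; exact: (idealD im).
  - exists (a * x); first exact: (subalgM sB).
    by rewrite mulrCA -mulrBr; exact: (idealMl im).
have [//|nJ1] := EM (J 1).
case: nmb; apply: (mmax _ iJ) => //.
by exists 1; [exact: (subalg1 sB)|rewrite mulr1 subrr; exact: ideal0 im].
Qed.

Lemma maximal_ideal_prime m b b' : maximal_ideal B m -> B b -> B b' ->
  ~ m b -> ~ m b' -> ~ m (b * b').
Proof.
move=> mm Bb Bb' nb nb' mbb'; apply: nb'.
have [x Bx h] := maximal_ideal_inv mm Bb nb; have [im _ _] := mm.
rewrite (_ : b' = b' * (1 - b * x) + x * (b * b')); last by ring.
by apply: (idealD im); apply: (idealMl im).
Qed.

Lemma localization_sub m : maximal_ideal B m -> B `<=` localization B m.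
Proof.
move=> [_ m1 _] b Bb; exists b, 1; split=> //; first exact: (subalg1 sB).
by rewrite divr1.
Qed.

Lemma localization_subalg m : maximal_ideal B m -> subalg iota (localization B m).
Proof.
move=> mm; have [im m1 _] := mm.
have nz b : ~ m b -> b != 0 by apply: contra_not_neq => ->; exact: ideal0 im.
split=> [c|_ _ [a [b [Ba Bb nb ->]]] [a' [b' [Ba' Bb' nb' ->]]]
          |_ _ [a [b [Ba Bb nb ->]]] [a' [b' [Ba' Bb' nb' ->]]]].
- by apply: localization_sub => //; exact: (subalgC sB).
- exists (a * b' + a' * b), (b * b'); split; [|exact: (subalgM sB)| |].
  + by apply: (subalgD sB); exact: (subalgM sB).
  + exact: maximal_ideal_prime.
  + by field; rewrite !nz.
- exists (a * a'), (b * b'); split; [exact: (subalgM sB)|exact: (subalgM sB)| |].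
  + exact: maximal_ideal_prime.
  + by field; rewrite !nz.
Qed.

Lemma localization_unit m b : maximal_ideal B m -> B b -> ~ m b ->
  localization B m b^-1.
Proof.
move=> [im m1 _] Bb nb; exists 1, b; split=> //; first exact: (subalg1 sB).
by rewrite mul1r.
Qed.

Lemma localization_nonunit m a h : maximal_ideal B m -> m a ->
  localization B m h -> a * h <> 1.
Proof.
move=> [im m1 _] ma [x [y [Bx By ny ->]]] e; apply: ny.
have y0 : y != 0.
  by apply: contra_eq_neq e => ->; rewrite invr0 !mulr0 eq_sym oner_neq0.
have -> : y = x * a by rewrite mulrC -[LHS]mul1r -e mulrA divfK.
exact: (idealMl im).
Qed.

Lemma exists_maximal_ideal J : ideal_of B J -> ~ J 1 ->
  exists2 m, maximal_ideal B m & J `<=` m.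
Proof.
move=> iJ J1.
pose P := [set A : set K | A = set0 \/ [/\ ideal_of B A, J `<=` A & ~ A 1]].
have [F FP totF|A [PA maxA]] := @Zorn_bigcup _ P.
  have [[A0 FA0 A0n]|F0] := EM (exists2 A, F A & A !=set0); last first.
    left; apply/seteqP; split=> // x [A FA Ax]; case: F0; exists A => //.
    by exists x.
  right.
  have FI A x : F A -> A x -> [/\ ideal_of B A, J `<=` A & ~ A 1].
    by move=> /FP [->|].
  have [x0 A0x] := A0n; have [iA0 JA0 _] := FI _ _ FA0 A0x.
  split; [split|..].
  - by move=> x [A FA Ax]; have [[+ _ _ _] _ _] := FI _ _ FA Ax; exact.
  - by exists A0 => //; exact: ideal0 iA0.
  - move=> a b [A FA Aa] [A' FA' A'b].
    have [iA _ _] := FI _ _ FA Aa; have [iA' _ _] := FI _ _ FA' A'b.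
    have [AA'|A'A] := totF _ _ FA FA'.
      by exists A' => //; apply: (idealD iA') => //; exact: AA'.
    by exists A => //; apply: (idealD iA) => //; exact: A'A.
  - move=> a b Ba [A FA Ab]; exists A => //; have [iA _ _] := FI _ _ FA Ab.
    exact: (idealMl iA).
  - by move=> x Jx; exists A0 => //; exact: JA0.
  - by move=> [A FA A1]; have [_ _] := FI _ _ FA A1; exact.
have PJ : P J by right; split.
case: PA => [A0|[iA JA A1]].
  case: (maxA J) => //; rewrite A0; split=> //.
  by move=> /(_ 0 (ideal0 iJ)).
exists A => //; split=> // J' iJ' AJ' J'1.
apply: contrapT => nJ'A; apply: (maxA J'); first by split.
by right; split=> //; exact: subset_trans AJ'.
Qed.

(* The denominators of f form an ideal of B contained in no maximal ideal. *)
Lemma localization_bigcap f :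
  (forall m, maximal_ideal B m -> localization B m f) -> B f.
Proof.
move=> fm; pose J := [set b | B b /\ B (b * f)].
have [[_]|J1] := EM (J 1); first by rewrite mul1r.
have iJ : ideal_of B J.
  split=> [b []||a b [? ?] [? ?]|a b Ba [? ?]] //.
  - by split; rewrite ?mul0r; exact: (subalg0 sB).
  - by split; rewrite ?mulrDl; exact: (subalgD sB).
  - by split; rewrite -?mulrA; exact: (subalgM sB).
have [m mm Jm] := exists_maximal_ideal iJ J1.
have [a [b [Ba Bb nb e]]] := fm m mm; case: (nb); apply: Jm; split=> //.
have b0 : b != 0 by apply: contra_not_neq nb => ->; case: mm => /ideal0.
by rewrite e mulrC divfK.
Qed.
End MaximalIdeals.

Lemma rmorph_evp (R S T : comNzRingType) (iota : {rmorphism R -> S})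
    (phi : {rmorphism S -> T}) x p :
  phi (evp iota x p) = evp (phi \o iota) (phi x) p.
Proof.
rewrite !evpE rmorph_sum; apply: eq_bigr => i _.
by rewrite rmorphM rmorphXn.
Qed.

Lemma evp_idE (R : comNzRingType) (p : {poly R}) : evp polyC 'X p = p.
Proof.
rewrite evpE -[RHS]coefK poly_def; apply: eq_bigr => i _.
by rewrite mul_polyC.
Qed.

Section Curve.
Context {k : fieldType} {X : proj_scheme k}.
Local Notation K := (funfield X).
Local Notation iota := (scalars X).
Implicit Types (i j : 'I_(ambient X).+1) (P : closed_point X).

Lemma chart_subalg i : subalg iota (chart i).
Proof.
split=> [c|_ _ [F ->] [G ->]|_ _ [F ->] [G ->]].
- by exists c%:MP; rewrite mmapC.
- by exists (F + G); rewrite rmorphD.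
- by exists (F * G); rewrite rmorphM.
Qed.

Lemma chart_gen i j : chart i (generic j / generic i).
Proof. by exists 'X_j; rewrite mmapX mmap1U. Qed.

Lemma chart_min i (B : set K) : subalg iota B ->
  (forall j, B (generic j / generic i)) -> chart i `<=` B.
Proof. by move=> sB Bg _ [F ->]; exact: subalg_mmap. Qed.

Lemma stalk_subalg P : subalg iota (stalk P).
Proof.
have [i [m [_ mm ->]]] := stalkP P.
exact: (localization_subalg (chart_subalg i)).
Qed.

Hypothesis curve : is_curve X.

Lemma curve_algdep2 : algdep2 iota.
Proof.
case: curve => _ _ dep x y.
pose f (i : 'I_2) := if i == ord0 then x else y.
have /existsNP [F /not_implyP [Ff F0]] := dep f.
by apply: (mmap_rel2 (f := f)) Ff; apply/eqP.
Qed.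

Lemma curve_transc : exists x, transc iota x.
Proof.
case: curve => _ [f indf] _; exists (f ord0) => p px.
pose F := evp (@mpolyC 1 k) 'X_ord0 p.
have /indf F0 : mmap iota f F = 0.
  rewrite -[RHS]px /F (rmorph_evp _ (mmap iota f)) /= mmapX mmap1U !evpE.
  by apply: eq_bigr => i _; rewrite /= mmapC.
have := congr1 (mmap polyC (fun=> 'X)) F0.
rewrite rmorph0 /F (rmorph_evp _ (mmap polyC (fun=> 'X))) /= mmapX mmap1U.
move=> <-; rewrite -[LHS]evp_idE !evpE.
by apply: eq_bigr => i _; rewrite /= mmapC.
Qed.

(** [is_curve] writes z as a fraction in a chart depending on z; the transition formula g_l / g_j =
    (g_l / g_i) / (g_j / g_i) carries it to the chart chosen here. *)
Lemma chart_frac i (z : K) : generic i != 0 ->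
  exists a b, [/\ chart i a, chart i b, b != 0 & z = a / b].
Proof.
move=> gi0; have sC := chart_subalg i.
pose B := [set z : K | exists a b, [/\ chart i a, chart i b, b != 0 & z = a / b]].
have sub : chart i `<=` B.
  move=> a Ca; exists a, 1; split=> //; [exact: (subalg1 sC)|exact: oner_neq0|].
  by rewrite divr1.
have sB : subalg iota B.
  split=> [c|_ _ [a [b [? ? b0 ->]]] [a' [b' [? ? b'0 ->]]]
            |_ _ [a [b [? ? b0 ->]]] [a' [b' [? ? b'0 ->]]]].
  - by apply: sub; exact: (subalgC sC).
  - exists (a * b' + a' * b), (b * b').
    split; [|exact: (subalgM sC)|by rewrite mulf_neq0|by field; rewrite ?b0 ?b'0].
    by apply: (subalgD sC); exact: (subalgM sC).
  - exists (a * a'), (b * b').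
    split; [exact: (subalgM sC)..|by rewrite mulf_neq0|by field; rewrite ?b0 ?b'0].
have BV a b : B a -> B b -> b != 0 -> B (a / b).
  move=> [x [y [? ? y0 ->]]] [x' [y' [? ? y'0 ->]]] nz.
  have x'0 : x' != 0 by apply: contraNneq nz => ->; rewrite mul0r.
  exists (x * y'), (y * x').
  split; [exact: (subalgM sC)..|by rewrite mulf_neq0|by field; rewrite ?y0 ?x'0 ?y'0].
have gB j l : generic j != 0 -> B (generic l / generic j).
  move=> gj0; have -> : generic l / generic j =
    (generic l / generic i) / (generic j / generic i) by field; rewrite ?gi0 ?gj0.
  by apply: BV; [exact/sub/chart_gen..|rewrite mulf_neq0 // invr_neq0].
case: curve => /(_ z) [j [a [b [gj0 Ca Cb b0 ->]]]] _ _.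
have CB : chart j `<=` B by apply: chart_min => // l; exact: gB.
by apply: BV => //; exact: CB.
Qed.

Section Point.
Variables (P : closed_point X) (t : K).
Hypothesis Pt : uniformizer P t.
Local Notation O := (stalk P).

Let sO : subalg iota O := stalk_subalg P.

Lemma stalk_maxE f : stalk_max P f <-> exists2 a, O a & f = t * a.
Proof. by rewrite Pt. Qed.

Lemma uniformizer_stalk : O t.
Proof.
suff [] : stalk_max P t by [].
by rewrite stalk_maxE; exists 1; [exact: (subalg1 sO)|rewrite mulr1].
Qed.

Lemma stalk_unit1 : stalk_unit P 1.
Proof. by split; [|exists 1; rewrite ?mulr1 //]; exact: (subalg1 sO). Qed.

Lemma stalk_unit_neq0 u : stalk_unit P u -> u != 0.
Proof.
by move=> [_ [h _ e]]; apply: contra_eq_neq e => ->; rewrite mul0r eq_sym oner_neq0.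
Qed.

Lemma stalk_unitE u : stalk_unit P u <-> [/\ O u, O u^-1 & u != 0].
Proof.
split=> [uu|[Ou Ou' u0]]; last by split=> //; exists u^-1 => //; rewrite divff.
have u0 := stalk_unit_neq0 uu; case: uu => Ou [h Oh e]; split=> //.
by rewrite (_ : u^-1 = h) // -[RHS](mulKf u0) e mulr1.
Qed.

Lemma stalk_unitV u : stalk_unit P u -> stalk_unit P u^-1.
Proof. by move=> /stalk_unitE [? ? ?]; apply/stalk_unitE; rewrite invrK invr_neq0. Qed.

Lemma stalk_unitM u v : stalk_unit P u -> stalk_unit P v -> stalk_unit P (u * v).
Proof.
move=> /stalk_unitE [? ? ?] /stalk_unitE [? ? ?]; apply/stalk_unitE.
by rewrite invfM mulf_neq0 //; split=> //; exact: (subalgM sO).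
Qed.

Lemma stalk_unitC c : c != 0 -> stalk_unit P (iota c).
Proof.
move=> c0; apply/stalk_unitE; rewrite -fmorphV fmorph_eq0.
by split=> //; exact: (subalgC sO).
Qed.

Lemma stalk_nonunit a : O a -> ~ stalk_unit P (t * a).
Proof. by move=> Oa; have [] : stalk_max P (t * a) by apply/stalk_maxE; exists a. Qed.

Lemma stalk_cases f : O f -> stalk_unit P f \/ exists2 a, O a & f = t * a.
Proof.
move=> Of; have [|nu] := EM (stalk_unit P f); first by left.
by right; apply/stalk_maxE; split.
Qed.

(* Otherwise the chart around P would be a field. *)
Lemma uniformizer_neq0 : t != 0.
Proof.
apply/eqP => t0.
have [i [m [gi0 mm e]]] := stalkP P; have sC := chart_subalg i.
have m0 a : m a -> a = 0.
  move=> ma; have : stalk_max P a.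
    have Oa : O a.
      by rewrite e; apply: (localization_sub sC mm); case: mm => -[+ _ _ _] _ _; exact.
    split=> // -[_ [h Oh]]; rewrite e in Oh.
    exact: (localization_nonunit mm ma Oh).
  by move=> /stalk_maxE [b _ ->]; rewrite t0 mul0r.
have [x tx] := curve_transc.
have [z hz] := fg_algebra_not_field
  (fun j => generic j / generic i) curve_algdep2 tx.
suff [F eF] : chart i z by exact: (hz F).
have [a [b [Ca Cb b0 ->]]] := chart_frac z gi0.
have nb : ~ m b by move=> /m0; exact/eqP.
have [y Cy /m0 /eqP] := maximal_ideal_inv sC mm Cb nb.
rewrite subr_eq0 => /eqP e1.
rewrite (_ : b^-1 = y); first exact: (subalgM sC).
by rewrite -[RHS](mulKf b0) -e1 mulr1.
Qed.

(** The lowest nonzero coefficient of p is a unit, and the later terms change it only by multiples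
    of t. *)
Lemma evp_uniformizer p : p != 0 ->
  exists n u, stalk_unit P u /\ evp iota t p = t ^+ n * u.
Proof.
elim/poly_ind: p => [|p c IHp]; first by rewrite eqxx.
have [->|c0 _] := eqVneq c 0.
  rewrite addr0 => p0; have {}p0 : p != 0 by apply: contraNneq p0 => ->; rewrite mul0r.
  have [n [u [uu e]]] := IHp p0; exists n.+1, u; split=> //.
  by rewrite rmorphM /= evpX e exprSr mulrAC.
exists 0%N, (evp iota t (p * 'X + c%:P)); split; last by rewrite mul1r.
have Op := subalg_evp sO p uniformizer_stalk.
have := subalg_evp sO (p * 'X + c%:P) uniformizer_stalk.
rewrite rmorphD rmorphM /= evpX evpC => h.
have [//|[a Oa e1]] := stalk_cases h.
have e : t * (a - evp iota t p) = iota c by rewrite mulrBr -e1; ring.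
have := stalk_unitC c0; rewrite -e => /stalk_nonunit []; exact: (subalgB sO).
Qed.

(** Finiteness of the order comes from algebraic dependence: the relation between t and f makes f
    divide some nonzero p(t), which is t^n times a unit, and n then bounds how often t can be split
    off from f. *)
Lemma stalk_factor f : O f -> f != 0 ->
  exists n u, stalk_unit P u /\ f = t ^+ n * u.
Proof.
move=> Of f0; have Ot := uniformizer_stalk.
have [F F0 eF] := curve_algdep2 t f.
have [p [b [p0 Ob e]]] := ev2_root_dvd sO Ot Of f0 F0 eF.
have [n [u [uu eu]]] := evp_uniformizer p0; rewrite e in eu.
elim: n f Of f0 eu {F F0 eF p p0 e} => [|n IHn] f Of f0 eu.
  exists 0%N, f; split; last by rewrite mul1r.
  have /stalk_unitE [Ou Ou' u0] := uu.
  split=> //; exists (b / u); first exact: (subalgM sO).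
  by rewrite mulrA eu mul1r divff.
have [uf|[a Oa ef]] := stalk_cases Of.
  by exists 0%N, f; rewrite mul1r.
have a0 : a != 0 by apply: contraNneq f0; rewrite ef => ->; rewrite mulr0.
have [|m [v [uv ea]]] := IHn a Oa a0.
  apply: (mulfI uniformizer_neq0); rewrite mulrA -ef eu exprS; ring.
by exists m.+1, v; rewrite ef ea exprS mulrA.
Qed.

Lemma field_factor f : f != 0 ->
  exists (n : int) u, stalk_unit P u /\ f = t ^ n * u.
Proof.
have t0 := uniformizer_neq0.
move=> f0; have [i [m [gi0 mm e]]] := stalkP P; have sC := chart_subalg i.
have [a [b [Ca Cb b0 ef]]] := chart_frac f gi0.
have a0 : a != 0 by apply: contraNneq f0; rewrite ef => ->; rewrite mul0r.
have CO : chart i `<=` O by rewrite e; exact: (localization_sub sC).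
have [n [u [uu eu]]] := stalk_factor (CO _ Ca) a0.
have [n' [v [uv ev]]] := stalk_factor (CO _ Cb) b0.
exists (n%:Z - n'%:Z), (u / v); split.
  by apply: stalk_unitM => //; exact: stalk_unitV.
rewrite ef eu ev expfzDr // -invr_expz -!exprnP.
by field; rewrite expf_neq0 // (stalk_unit_neq0 uv).
Qed.

Lemma factor_stalk (n : int) u : stalk_unit P u -> O (t ^ n * u) <-> 0 <= n.
Proof.
have t0 := uniformizer_neq0.
move=> uu; have /stalk_unitE [Ou Ou' u0] := uu; split; last first.
  by case: n => // n _; apply: (subalgM sO) => //; apply: (subalgX sO); exact: uniformizer_stalk.
case: n => // n h; exfalso.
(* [Negz n] is -(n + 1), so this product is t^-1, although t is not a unit. *)
have : O (t ^+ n * (t ^ Negz n)).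
  apply: (subalgM sO); first by apply: (subalgX sO); exact: uniformizer_stalk.
  by rewrite -[t ^ _](mulfK u0); exact: (subalgM sO).
rewrite NegzE exprnP -expfzDr // (_ : n%:Z - n.+1%:Z = -1) => [Ot'|]; last by lia.
apply: (stalk_nonunit Ot'); rewrite exprN1 divff //; exact: stalk_unit1.
Qed.

Lemma factor_unit (n : int) u : stalk_unit P u -> stalk_unit P (t ^ n * u) -> n = 0.
Proof.
move=> uu /stalk_unitE [h h' _].
have n0 := (factor_stalk n uu).1 h.
rewrite invfM invr_expz in h'.
have := (factor_stalk (- n) (stalk_unitV uu)).1 h'; lia.
Qed.

Lemma factor_inj (n m : int) u v : stalk_unit P u -> stalk_unit P v ->
  t ^ n * u = t ^ m * v -> n = m.
Proof.
move=> uu uv e; have t0 := uniformizer_neq0; apply/eqP; rewrite -subr_eq0; apply/eqP.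
apply: (factor_unit uu); rewrite expfzDr // mulrAC e mulrAC -expfzDr //.
by rewrite subrr mul1r.
Qed.

Lemma stalk_max_div x : O x -> (stalk_max P x <-> O (x / t)).
Proof.
have t0 := uniformizer_neq0; move=> Ox; rewrite stalk_maxE; split=> [[a Oa ->]|h].
  by rewrite mulrAC divff // mul1r.
by exists (x / t) => //; rewrite mulrC divfK.
Qed.

Lemma field_denominator f : exists N : nat, O (t ^ N%:Z * f).
Proof.
have [->|f0] := eqVneq f 0.
  by exists 0%N; rewrite mulr0; exact: (subalg0 sO).
have [n [u [uu ->]]] := field_factor f0; exists `|n|%N.
rewrite mulrA -expfzDr ?uniformizer_neq0 //; apply/(factor_stalk _ uu); lia.
Qed.

Lemma stalk_max_subspace : subspace (stalk_max P : set (restr iota K^o)).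
Proof.
split=> [|a u v /stalk_maxE [x Ox ->] /stalk_maxE [y Oy ->]]; apply/stalk_maxE.
  by exists 0; [exact: (subalg0 sO)|rewrite mulr0].
exists (iota a * x + y).
  by apply: (subalgD sO) => //; apply: (subalgM sO) => //; exact: (subalgC sO).
by rewrite restr_scaleE /GRing.scale /= mulrDr mulrCA.
Qed.

Lemma stalk_subspace : subspace (O : set (restr iota K^o)).
Proof.
split=> [|a u v Ou Ov]; first exact: (subalg0 sO).
by apply: (subalgD sO) => //; apply: (subalgM sO) => //; exact: (subalgC sO).
Qed.

End Point.
End Curve.

(** * Finiteness of residue fields *)

Section ResidueField.
Context {k : fieldType} {X : proj_scheme k}.
Local Notation K := (funfield X).
Local Notation iota := (scalars X).
Hypothesis curve : is_curve X.
Variables (P : closed_point X) (t : K).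
Hypothesis Pt : uniformizer P t.
Local Notation O := (stalk P).

Let sO : subalg iota O := stalk_subalg P.
Let M : set K := [set z | exists2 a, O a & z = t * a].

Let M0 : M 0. Proof. by exists 0; [exact: (subalg0 sO)|rewrite mulr0]. Qed.
Let MD a b : M a -> M b -> M (a + b).
Proof.
by move=> [x Ox ->] [y Oy ->]; exists (x + y); [exact: (subalgD sO)|rewrite mulrDr].
Qed.
Let MM a b : O a -> M b -> M (a * b).
Proof.
by move=> Oa [y Oy ->]; exists (a * y); [exact: (subalgM sO)|rewrite mulrCA].
Qed.
Let MO a : M a -> O a.
Proof. by move=> [x Ox ->]; apply: (subalgM sO) => //; exact: (uniformizer_stalk Pt). Qed.

(* A transcendental residue class would make its lift algebraically
   independent from the uniformizer. *)
Lemma residue_algebraic u : O u -> exists2 p : {poly k}, p != 0 & M (evp iota u p).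
Proof.
move=> Ou; have [F F0 eF] := curve_algdep2 curve u t.
have [p [b [p0 Ob e]]] := ev2_root_dvd sO Ou (uniformizer_stalk Pt)
  (uniformizer_neq0 curve Pt) F0 eF.
by exists p => //; exists b.
Qed.

Let congr_prod (I : finType) (x x' : I -> K) : (forall i, O (x i)) ->
  (forall i, M (x i - x' i)) -> M (\prod_i x i - \prod_i x' i).
Proof.
move=> Ox Mx.
suff [] : O (\prod_i x i) /\ M (\prod_i x i - \prod_i x' i) by [].
apply: (big_ind2 (fun a b => O a /\ M (a - b))) => [|a a' b b' [Oa Ma] [Ob Mb]|i _].
- by split; [exact: (subalg1 sO)|rewrite subrr].
- split; first exact: (subalgM sO).
  rewrite (_ : _ - _ = a * (b - b') + b' * (a - a')); last by ring.
  apply: MD; apply: MM => //.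
  by rewrite -[b'](subKr b); apply: (subalgB sO) => //; exact: MO.
- by [].
Qed.

(** The chart is generated by finitely many y_j, each with algebraic residue class. Monomials in the
    y_j with exponents below a common bound D therefore span the chart modulo M, and every fraction
    in O is congruent to a chart element. *)
Lemma residue_finite :
  exists n, dimq (O : set (restr iota K^o)) (stalk_max P) n.
Proof.
have [i [m [gi0 mm e]]] := stalkP P; have sC := chart_subalg i.
pose y j := generic j / generic i.
have CO : chart i `<=` O by rewrite e; exact: (localization_sub sC).
have Oy j : O (y j) by apply: CO; exact: chart_gen.
have /choice [p hp] : forall j, exists p : {poly k}, p != 0 /\ M (evp iota (y j) p).
  by move=> j; have [p] := residue_algebraic (Oy j); exists p.
pose D := \max_j size (p j).
(* Euclidean division of X^n by [p j], whose value at [y j] lies in M. *)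
have red j n : exists r : {poly k}, (size r <= D)%N /\ M (y j ^+ n - evp iota (y j) r).
  have [p0 Mp] := hp j; exists ('X^n %% p j); split.
    apply: leq_trans (leq_bigmax j); apply: ltnW; by rewrite ltn_modp.
  have {1}-> : y j ^+ n = evp iota (y j) 'X^n by rewrite rmorphXn /= evpX.
  rewrite -rmorphB {1}(divp_eq 'X^n (p j)) addrK rmorphM.
  by apply: MM => //; exact: (subalg_evp sO).
pose E := {ffun 'I_(ambient X).+1 -> 'I_D}.
pose b (f : E) : restr iota K^o := \prod_j y j ^+ f j.
pose S := [set v : restr iota K^o | exists c : E -> k, M (v - \sum_f c f *: b f)].
have SD u v : S u -> S v -> S (u + v).
  move=> [c hc] [c' hc']; exists (fun f => c f + c' f).
  have -> : \sum_f (c f + c' f) *: b f = \sum_f c f *: b f + \sum_f c' f *: b f.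
    by rewrite -big_split; apply: eq_bigr => f _; rewrite scalerDl.
  by rewrite opprD addrACA; exact: MD.
have SM u v : S v -> M (u - v) -> S u.
  by move=> [c hc] h; exists c; rewrite -(subrKA v); exact: MD.
have CS : chart i `<=` S.
  move=> _ [F ->]; rewrite -/y /mmap; apply: (big_ind S) => //.
    by exists (fun=> 0); rewrite big1 ?subr0 // => f _; rewrite scale0r.
  move=> mn _.
  have /choice [r hr] : forall j, exists r : {poly k}, (size r <= D)%N /\
    M (y j ^+ mn j - evp iota (y j) r) by move=> j; exact: red.
  exists (fun f : E => F@_mn * \prod_j (r j)`_(f j)).
  have -> : \sum_(f : E) (F@_mn * \prod_j (r j)`_(f j)) *: b f =
      iota F@_mn * \prod_j evp iota (y j) (r j).
    under [X in _ = _ * X]eq_bigr => j _.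
      have -> : evp iota (y j) (r j) = \sum_(l < D) iota (r j)`_l * y j ^+ l.
        rewrite /evp /horner_morph (@horner_coef_wide _ D).
          by apply: eq_bigr => l _; rewrite coef_map.
        by apply: leq_trans (size_poly _ _) _; case: (hr j).
      over.
    rewrite bigA_distr_bigA mulr_sumr; apply: eq_bigr => f _.
    rewrite restr_scaleE /GRing.scale /= rmorphM rmorph_prod -mulrA -big_split.
    by [].
  rewrite -mulrBr; apply: MM; first exact: (subalgC sO).
  apply: congr_prod => j; first exact: (subalgX sO).
  by case: (hr j).
(* The denominator c has an inverse x modulo m, so a / c is congruent to the chart element a x. *)
have OS : O `<=` S.
  move=> v; rewrite e => -[a [c [Ca Cc nc ->]]].
  have [x Cx mx] := maximal_ideal_inv sC mm Cc nc.
  apply: (SM _ (a * x)); first by apply: CS; exact: (subalgM sC).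
  have c0 : c != 0 by apply: contra_not_neq nc => ->; case: mm => /ideal0.
  have -> : a / c - a * x = (a / c) * (1 - c * x) by field.
  apply: MM.
    apply: (subalgM sO); first exact: CO.
    by rewrite e; exact: (localization_unit sC).
  apply/(stalk_maxE Pt); split.
    by apply: CO; case: mm => -[+ _ _ _] _ _; exact.
  move=> -[_ [h Oh]]; rewrite e in Oh.
  exact: (localization_nonunit mm mx Oh).
have [||||n _ hn] := @dimq_span _ _ (O : set (restr iota K^o)) (stalk_max P)
  #|E| (fun l => b (enum_val l)); last by exists n.
- exact: stalk_subspace.
- exact: (stalk_max_subspace Pt).
- by move=> l; apply: (subalg_prod sO) => j _; exact: (subalgX sO).
- move=> v /OS [c hc]; exists (\row_l c (enum_val l)).
  apply/(stalk_maxE Pt).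
  rewrite (_ : \sum_(l < #|E|) _ = \sum_f c f *: b f) //.
  rewrite (reindex (fun l : 'I_#|E| => enum_val l)) /=; last first.
    by apply: onW_bij; exact: enum_val_bij.
  by apply: eq_bigr => l _; rewrite mxE.
Qed.
End ResidueField.

(** * Global functions *)

Section GlobalFunctions.
Context {k : fieldType} {X : proj_scheme k}.
Local Notation K := (funfield X).
Local Notation iota := (scalars X).
Hypothesis curve : is_curve X.
Local Notation N := (ambient X).

Lemma generic_neq0 : exists i, @generic _ X i != 0.
Proof. by case: curve => /(_ 0) [i [a [b []]]]; exists i. Qed.

Let V := restr iota K^o.
Let mono (m : 'X_{1..N.+1}) : V := \prod_j generic j ^+ m j.

(** Degree d forms evaluated at the generic point: a finite-dimensional space on which a global
    function will act. *)
Let forms (d : nat) : set V := [set v | exists F : {mpoly k[N.+1]},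
  v = \sum_(m : 'X_{1..N.+1 < d.+1} | mdeg m == d) F@_m *: mono m].

Let forms_subspace d : subspace (forms d).
Proof.
split=> [|a _ _ [F ->] [G ->]].
  by exists 0; rewrite big1 // => m _; rewrite mcoeff0 scale0r.
exists (a *: F + G); rewrite scaler_sumr -big_split; apply: eq_bigr => m _.
by rewrite mcoeffD mcoeffZ scalerDl scalerA.
Qed.

Let forms_mono m d : mdeg m = d -> forms d (mono m).
Proof.
move=> <-.
exists 'X_[m]; rewrite (bigD1 (BMultinom (ltnSn (mdeg m)))) //= mcoeffX eqxx scale1r.
rewrite big1 ?addr0 // => m' /andP [_ nm].
rewrite mcoeffX (_ : (m == m') = false) ?scale0r //.
by apply: contraNF nm => /eqP e; apply/eqP/val_inj; exact: esym e.
Qed.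

Let monoD m m' : mono (m + m') = (mono m : K) * mono m'.
Proof.
by rewrite /mono -big_split; apply: eq_bigr => j _; rewrite mnmDE exprD.
Qed.

Let mono1 i n : mono (U_(i) *+ n) = generic i ^+ n.
Proof.
rewrite /mono (bigD1 i) //= mulmnE mnm1E eqxx mul1n.
rewrite big1 ?mulr1 // => j ji; rewrite mulmnE mnm1E eq_sym (negbTE ji) mul0n.
by rewrite expr0.
Qed.

Let forms_mono_mul d m v : forms d v -> forms (mdeg m + d) ((mono m : K) * v).
Proof.
move=> [F ->]; rewrite mulr_sumr.
apply: (@subspace_sum _ V (forms (mdeg m + d))) => [|m' /eqP dm'].
  exact: forms_subspace.
have -> : (mono m : K) * (F@_m' *: mono m' : V) = F@_m' *: (mono (m + m') : V).
  by rewrite monoD !restr_scaleE /GRing.scale /= mulrCA.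
by apply: subspaceZ; [exact: forms_subspace|apply: forms_mono; rewrite mdegD dm'].
Qed.

(** Homogenization: multiplying a polynomial in the ratios by a high power of [generic i] clears
    denominators and fills up the degree. *)
Let chart_forms i f : generic i != 0 -> chart i f ->
  exists d, forall e, (d <= e)%N -> forms e (generic i ^+ e * f).
Proof.
move=> gi0 [F ->]; exists (msize F) => e le; rewrite /mmap mulr_sumr big_seq.
apply: (@subspace_sum _ V (forms e)) => [|m mF]; first exact: forms_subspace.
 have lm : (mdeg m <= e)%N.
  by apply: leq_trans le; apply: ltnW; exact: msize_mdeg_lt.
have -> : generic i ^+ e * (iota F@_m * mmap1 (fun j => generic j / generic i) m) =
    F@_m *: (mono (U_(i) *+ (e - mdeg m) + m) : V).
  have -> : mmap1 (fun j => generic j / generic i) m = (mono m : K) / generic i ^+ mdeg m.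
    rewrite /mmap1 /mono mdegE -prodrXr -prodfV -big_split /=.
    by apply: eq_bigr => j _; rewrite exprMn exprVn.
  have -> : mono (U_(i) *+ (e - mdeg m) + m) =
    generic i ^+ (e - mdeg m) * (mono m : K).
    by rewrite monoD mono1.
  rewrite restr_scaleE /GRing.scale /= -{1}(subnK lm) exprD.
  by field; rewrite expf_neq0.
apply: subspaceZ; first exact: forms_subspace.
by apply: forms_mono; rewrite mdegD mdegMn mdeg1 mul1n subnK.
Qed.

(* For d large every monomial of degree d is divisible by a high power of some
   coordinate, so f acts on the forms of degree d. *)
Lemma global_algebraic f : (forall P : closed_point X, stalk P f) ->
  exists2 p : {poly k}, p != 0 & evp iota f p = 0.
Proof.
move=> fP.
have fC i : generic i != 0 -> chart i f.
  move=> gi0; apply: (localization_bigcap (chart_subalg i)) => m mm.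
  have h : exists (i' : 'I_N.+1) (m' : set K), [/\ generic i' != 0,
    maximal_ideal (chart i') m' & localization (chart i) m = localization (chart i') m'].
    by exists i, m.
  exact: (fP (ClosedPoint h)).
have /choice [d hd] : forall i, exists d, generic i != 0 ->
    forall e, (d <= e)%N -> forms e (generic i ^+ e * f).
  move=> i; have [/eqP gi0|gi0] := boolP (generic i == 0); first by exists 0%N.
  by have [d hd] := chart_forms gi0 (fC i gi0); exists d.
(* The successor makes e positive. The pigeonhole on exponents needs this, and so does the vanishing
   of a monomial that involves a zero coordinate. *)
pose e := (\max_i d i).+1.
pose M := (N.+1 * e)%N.
have fF v : forms M v -> forms M (f * v).
  move=> [F ->]; rewrite mulr_sumr.
  apply: (@subspace_sum _ V (forms M)) => [|m /eqP dm]; first exact: forms_subspace.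
  have -> : f * (F@_m *: mono m : V) = F@_m *: ((f * mono m : K) : V).
    by rewrite !restr_scaleE /GRing.scale /= mulrCA.
  apply: subspaceZ; first exact: forms_subspace.
  have [i ei] : exists i, (e <= val m i)%N.
    apply: contrapT => nex.
    have lt i : (val m i < e)%N by rewrite ltnNge; apply/negP => h; apply: nex; exists i.
    have : (mdeg m <= \sum_(i < N.+1) e.-1)%N.
      by rewrite mdegE; apply: leq_sum => i _; exact: lt.
    by rewrite dm sum_nat_const card_ord /M leq_pmul2l // ltnn.
  have [gi0|gi0] := eqVneq (generic i) 0.
    rewrite (_ : mono m = 0) ?mulr0; first exact: subspace0 (forms_subspace _).
    rewrite /mono (bigD1 i) //= gi0 expr0n.
    by rewrite (gtn_eqF (leq_trans (ltn0Sn _) ei)) mul0r.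
  have em : (m - U_(i) *+ e + U_(i) *+ e = m)%MM.
    apply: submK; apply/mnm_lepP => j; rewrite mulmnE mnm1E.
    by case: eqP => [<-|_]; rewrite ?mul1n ?mul0n.
  have dem : (mdeg (m - U_(i) *+ e)%MM + e = M)%N.
    by have := dm; rewrite -{1}em mdegD mdegMn mdeg1 mul1n.
  have -> : f * (mono m : K) = (mono (m - U_(i) *+ e) : K) * (generic i ^+ e * f).
    by rewrite -{1}em monoD mono1 mulrCA [f * _]mulrC.
  have le : (d i <= e)%N by apply: leqW; exact: leq_bigmax.
  by have := forms_mono_mul (m - U_(i) *+ e)%MM (hd i gi0 _ le); rewrite dem.
(* All f^n g_i^M lie in one finite-dimensional space; a linear relation among them, divided by
   g_i^M, is an algebraic equation for f. *)
have [i gi0] := generic_neq0.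
pose u n : V := f ^+ n * generic i ^+ M.
have Fu n : forms M (u n).
  elim: n => [|n IHn]; last by rewrite /u exprS -mulrA; exact: fF.
  rewrite /u expr0 mul1r -mono1.
  by apply: forms_mono; rewrite mdegMn mdeg1 mul1n.
pose A := [set m : 'X_{1..N.+1 < M.+1} | mdeg m == M]%SET.
have [||||n _ hn] := @dimq_span _ _ (forms M) [set 0] #|A|
    (fun l : 'I_#|A| => mono (enum_val l)).
- exact: forms_subspace.
- exact: subspace_set0.
- by move=> l; have := enum_valP l; rewrite inE => /eqP; exact: forms_mono.
- move=> v [F ->]; exists (\row_(l < #|A|) F@_(enum_val l)); apply/eqP; rewrite subr_eq0; apply/eqP.
  rewrite [LHS](_ : _ = \sum_(m in A) F@_m *: mono m).
    by rewrite big_enum_val; apply: eq_bigr => l _; rewrite mxE.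
  by apply: eq_bigl => m; rewrite inE.
have [c c0 ec] := dimq_dep hn Fu.
exists (\poly_(l < n.+1) c ord0 (inord l)).
  apply: contraNneq c0 => /polyP h; apply/eqP/rowP => l.
  by have := h l; rewrite coef_poly ltn_ord inord_val coef0 mxE.
apply: (mulIf (expf_neq0 M gi0)); rewrite mul0r.
rewrite /evp /horner_morph (@horner_coef_wide _ n.+1); last first.
  exact: leq_trans (size_poly _ _) (size_poly _ _).
rewrite mulr_suml -[RHS]ec; apply: eq_bigr => l _.
by rewrite coef_map coef_poly ltn_ord inord_val restr_scaleE /GRing.scale /= mulrA.
Qed.
End GlobalFunctions.

(** * Consequences of smoothness and geometric connectedness *)

Section Transport.
Context {K K' : fieldType} (u : {rmorphism K -> K'}).
Hypothesis usurj : forall z, exists x, u x = z.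

Let uinj : injective u := fmorph_inj u.

Lemma image_mem (A : set K) x : (u @` A) (u x) = A x.
Proof. by apply/propext; split=> [[y Ay /uinj <-]|Ax] //; exists x. Qed.

Lemma image_maximal_ideal B m : maximal_ideal B m -> maximal_ideal (u @` B) (u @` m).
Proof.
move=> [[mB m0 mD mM] m1 mmax]; split; first split.
- by move=> _ [x mx <-]; exists x => //; exact: mB.
- by exists 0 => //; rewrite rmorph0.
- by move=> _ _ [x mx <-] [y my <-]; exists (x + y); [exact: mD|rewrite rmorphD].
- by move=> _ _ [x Bx <-] [y my <-]; exists (x * y); [exact: mM|rewrite rmorphM].
- by rewrite -(rmorph1 u) image_mem.
move=> J [JB J0 JD JM] mJ J1.
have h : (u @^-1` J) `<=` m.
  apply: mmax; last by rewrite /= rmorph1.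
    split=> [x /JB||a b Ja Jb|a b Ba Jb].
    - by rewrite image_mem.
    - by rewrite /= rmorph0.
    - by rewrite /= rmorphD; exact: JD.
    - by rewrite /= rmorphM; apply: JM => //; exists a.
  by move=> x mx; apply: mJ; exists x.
move=> z; have [x <-] := usurj z; move=> Jx; exists x => //; exact: h.
Qed.

Lemma image_localization B m :
  u @` (localization B m) = localization (u @` B) (u @` m).
Proof.
apply/seteqP; split=> z.
  move=> [_ [a [b [Ba Bb nb ->]]] <-]; exists (u a), (u b).
  by rewrite !image_mem fmorph_div.
move=> [_ [_ [[a Ba <-] [b Bb <-] nb ->]]]; exists (a / b); last by rewrite fmorph_div.
by exists a, b; split=> //; move: nb; rewrite image_mem.
Qed.
End Transport.

(** Smoothness provides regular base changes; the one along the identity of k is a copy of X. Its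
    field map u is onto, since the target is generated by ratios of coordinates, so regularity can
    be pulled back along u. *)
Lemma smooth_regular (k : fieldType) (X : proj_scheme k) :
  smooth_geom_connected X -> is_regular X.
Proof.
move=> /(_ k idfun) [[K' s' N' g'] [[u [us _ [/= e ug]]] curve' reg']].
(* Both schemes are destructed so that the equality of ambient dimensions can be eliminated and the
   coordinates share one index type. *)
case: X u us e ug => [K s N g] /= u us e; case: _ / e in g' curve' reg' * => ug.
have {}ug i : u (g i) = g' i by rewrite ug; congr g'; apply: val_inj.
set X := ProjScheme s g; set X' := ProjScheme s' g' in curve' reg'.
have chartE (i : 'I_N.+1) F : mmap s' (fun j => g' j / g' i) F =
    u (mmap s (fun j => g j / g i) F).
  rewrite rmorph_mmap; apply: eq_mmap => [c|j] /=; first exact: esym (us c).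
  by rewrite fmorph_div !ug.
have usurj z : exists x, u x = z.
  case: curve' => /(_ z) [i [a [b [_ [F ->] [G ->] _ ->]]]] _ _.
  exists (mmap s (fun j => g j / g i) F / mmap s (fun j => g j / g i) G).
  by rewrite fmorph_div !chartE.
have uchart (i : 'I_N.+1) : u @` @chart _ X i = @chart _ X' i.
  apply/seteqP; split=> [_ [_ [F ->] <-]|_ [F ->]]; first by exists F; rewrite /= chartE.
  by exists (mmap s (fun j => g j / g i) F); [exists F|rewrite /= chartE].
move=> P; have [i [m [gi0 mm eP]]] := stalkP P.
have hP' : exists (i0 : 'I_(ambient X').+1) (m0 : set (funfield X')),
    [/\ generic i0 != 0, maximal_ideal (chart i0) m0
      & u @` stalk P = localization (chart i0) m0].
  exists i, (u @` m); split.
  - by rewrite /= -ug fmorph_eq0.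
  - by rewrite -uchart; exact: image_maximal_ideal.
  - by rewrite eP image_localization uchart.
have [t' ut'] := reg' (ClosedPoint hP').
have [t et] := usurj t'; exists t; rewrite -{}et in ut'.
have uunit x : stalk_unit (ClosedPoint hP') (u x) <-> stalk_unit P x.
  have eS : stalk (ClosedPoint hP') = u @` stalk P by [].
  split=> -[Px [h Ph e]].
    move: Px Ph e; rewrite eS image_mem => Px [y Py <-].
    rewrite -rmorphM -(rmorph1 u) => /fmorph_inj e.
    by split=> //; exists y.
  split; first by rewrite eS image_mem.
  by exists (u h); [rewrite eS image_mem|rewrite -rmorphM e rmorph1].
rewrite /uniformizer; apply/seteqP; split=> f.
  move=> [Pf nf].
  have : stalk_max (ClosedPoint hP') (u f).
    by split=> [|/uunit]; [exists f|].
  rewrite ut' => -[_ [a Pa <-]]; rewrite -rmorphM => /fmorph_inj ->.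
  by exists a.
move=> [a Pa ->].
have : stalk_max (ClosedPoint hP') (u (t * a)).
  by rewrite ut'; exists (u a); [exists a|rewrite rmorphM].
by rewrite -[stalk_max _]/((u @` stalk P) `\` _) => -[]; rewrite image_mem => Pf nf; split=> // /uunit.
Qed.

(* Base change to the function field K itself: an algebraic f in K outside k
   would give two distinct copies of f in the function field of the base
   change, both roots of the minimal polynomial of f, against linear
   disjointness. *)
Lemma algebraic_const (k : fieldType) (X : proj_scheme k) (f : funfield X) :
  smooth_geom_connected X ->
  (exists2 p : {poly k}, p != 0 & evp (scalars X) f p = 0) ->
  exists c, f = scalars X c.
Proof.
move=> /(_ _ (scalars X)) [X' [[u [us disj _]] _ _]] algf.
set s := scalars X in us disj algf *; set s' := scalars X' in us disj.
pose Q n := `[< exists p : {poly k}, [/\ p != 0, evp s f p = 0 & size p = n] >].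
have exQ : exists n, Q n.
  by case: algf => p p0 ep; exists (size p); apply/asboolP; exists p.
case: (ex_minnP exQ) => d /asboolP [p [p0 ep sp]] minp.
have {}minp q : evp s f q = 0 -> (size q < d)%N -> q = 0.
  move=> eq; apply: contraTeq => q0; rewrite -leqNgt; apply: minp.
  by apply/asboolP; exists q.
apply: contrapT => nf.
have [n dn] : exists n, d = n.+2.
  have : (1 < d)%N.
    rewrite ltnNge -sp; apply/negP => /size1_polyC e.
    move: ep p0; rewrite e evpC => /eqP; rewrite fmorph_eq0 => /eqP ->.
    by rewrite eqxx.
  by case: (d) => [|[|n]] // _; exists n.
(* Minimality of d makes the low powers of f independent over k, which is what linear disjointness
   asks of the second factors. *)
have indep m (c : 'I_m -> k) : (m < d)%N -> \sum_(i < m) s (c i) * f ^+ i = 0 ->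
    forall i, c i = 0.
  case: m c => [|m] c lm ec i; first by case: i.
  have := minp (\poly_(i < m.+1) c (inord i)).
  rewrite /evp /horner_morph (@horner_coef_wide _ m.+1); last first.
    exact: leq_trans (size_poly _ _) (size_poly _ _).
  under eq_bigr => l _ do rewrite coef_map coef_poly ltn_ord inord_val.
  move=> /(_ ec (leq_ltn_trans (size_poly _ _) lm)) /polyP /(_ i).
  by rewrite coef_poly ltn_ord inord_val coef0.
(* The coefficient of S^i in the divided difference (p(U) - p(S)) / (U - S), evaluated at U = f. *)
pose a i := \sum_(m < n.+2 | (i < m)%N) s p`_m * f ^+ (m - i.+1).
have key : (u f - s' f) * \sum_(i < n.+1) u (a i) * s' (f ^+ i) = 0.
  have pU : \sum_(m < n.+2) s' (s p`_m) * (u f) ^+ m = 0.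
    rewrite -[RHS](rmorph0 u) -ep evpE sp dn rmorph_sum.
    by apply: eq_bigr => m _; rewrite rmorphM rmorphXn us.
  have pS : \sum_(m < n.+2) s' (s p`_m) * (s' f) ^+ m = 0.
    rewrite -[RHS](rmorph0 s') -ep evpE sp dn rmorph_sum.
    by apply: eq_bigr => m _; rewrite rmorphM rmorphXn.
  have W (m : 'I_n.+2) : \sum_(i < m) u f ^+ (m.-1 - i) * s' f ^+ i =
      \sum_(i < n.+1 | (i < m)%N) u f ^+ (m.-1 - i) * s' f ^+ i.
    by apply: (big_ord_widen n.+1 (fun i => u f ^+ (m.-1 - i) * s' f ^+ i)); rewrite -ltnS.
  transitivity (\sum_(m < n.+2) s' (s p`_m) * (u f) ^+ m -
                \sum_(m < n.+2) s' (s p`_m) * (s' f) ^+ m).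
    rewrite -sumrB.
    have -> : \sum_(m < n.+2) (s' (s p`_m) * u f ^+ m - s' (s p`_m) * s' f ^+ m) =
        \sum_(m < n.+2) s' (s p`_m) * ((u f - s' f) *
          \sum_(i < n.+1 | (i < m)%N) u f ^+ (m.-1 - i) * s' f ^+ i).
      by apply: eq_bigr => m _; rewrite -mulrBr subrXX W.
    rewrite mulr_sumr.
    under eq_bigr => i _ do rewrite rmorph_sum mulr_suml mulr_sumr.
    rewrite (exchange_big_dep xpredT) //=; apply: eq_bigr => m _.
    rewrite mulrCA mulr_sumr mulr_sumr; apply: eq_bigr => i im.
    by rewrite rmorphM !rmorphXn us subnS -subn1 subnAC subn1; ring.
  by rewrite pU pS subrr.
have /eqP := key; rewrite mulf_eq0 => /orP [/eqP uf|/eqP].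
  (* Encodes u(f) s'(1) - u(1) s'(f) = 0, which contradicts disjointness because 1 and f are
     independent over k. *)
  pose a2 (i : 'I_2) := if i == ord0 then f else -1.
  pose b2 (i : 'I_2) := f ^+ i.
  have := disj 2%N a2 b2; rewrite !big_ord_recl !big_ord0.
  have ind2 : forall c : 'I_2 -> k, \sum_(i < 2) s (c i) * b2 i = 0 -> forall i, c i = 0.
    move=> c ec; have [d2|d2] := ltnP 2 d; first exact: (indep 2%N).
    case: nf; have sp2 : size p = 2%N by rewrite sp; apply/eqP; rewrite eqn_leq d2 dn.
    move: ep; rewrite evpE sp2 !big_ord_recl big_ord0 /= addr0 expr0 expr1 mulr1.
    have p1 : s p`_1 != 0.
      by rewrite fmorph_eq0 (_ : 1%N = (size p).-1) -?lead_coefE ?lead_coef_eq0 // sp2.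
    rewrite /bump /= addrC => /eqP; rewrite addr_eq0 => /eqP e.
    exists (- p`_0 / p`_1); rewrite fmorph_div rmorphN -e.
    by rewrite mulrAC divff ?mul1r.
  move=> /(_ ind2); rewrite /a2 /b2 /= expr0 expr1 !rmorph1 mulr1 addr0.
  rewrite rmorphN rmorph1 mulN1r => /(_ uf ord_max) /eqP /=.
  by rewrite oppr_eq0 oner_eq0.
move=> /(disj n.+1 (fun i => a i) (fun i => f ^+ i)) => h.
have /h /(_ ord_max) : forall c : 'I_n.+1 -> k, \sum_(i < n.+1) s (c i) * f ^+ i = 0 ->
    forall i, c i = 0 by move=> c; apply: indep; rewrite dn.
(* The last a_n is the leading coefficient of p, which cannot vanish. *)
rewrite /a /= (big_pred1 ord_max) => [/eqP|m] /=; last first.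
  by rewrite -(inj_eq val_inj) /= eqn_leq -[(m <= _)%N]ltnS ltn_ord.
rewrite subnn expr0 mulr1 fmorph_eq0.
have -> : p`_n.+1 = lead_coef p by rewrite lead_coefE sp dn.
by rewrite lead_coef_eq0 (negbTE p0).
Qed.

(** * Divisors and the Riemann-Roch formula in large degree *)

Section RiemannRoch.
Context {k : fieldType} (C : smooth_proj_curve k).
Local Notation K := (funfield C).
Local Notation iota := (scalars C).
Local Notation point := (closed_point C).
Implicit Types (P : point) (D : point -> int).

Let curve : is_curve C := curve_dim1 C.

Definition unif P : K := projT1 (cid (smooth_regular (curve_smooth C) P)).

Lemma unifP P : uniformizer P (unif P).
Proof. exact: (projT2 (cid (smooth_regular (curve_smooth C) P))). Qed.

Lemma unif_neq0 P : unif P != 0. Proof. exact: uniformizer_neq0 (unifP P). Qed.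

Let sO P : subalg iota (stalk P) := stalk_subalg P.

Lemma stalk_unif_ge P (m n : int) f : m <= n ->
  stalk P (unif P ^ m * f) -> stalk P (unif P ^ n * f).
Proof.
move=> mn h; rewrite -[n](subrK m) expfzDr ?unif_neq0 // -mulrA.
apply: (subalgM (sO P)) => //; rewrite -[_ ^ _]mulr1.
by apply/(factor_stalk curve (unifP P) _ (stalk_unit1 P)); rewrite subr_ge0.
Qed.

(** [valuation] may select any uniformizer, so the exponent has to be shown independent of that
    choice. *)
Lemma valuation_factor P (n : int) u : stalk_unit P u ->
  valuation P (unif P ^ n * u) = n.
Proof.
move=> uu; apply: xget_unique; first by exists (unif P), u; split=> //; exact: unifP.
move=> m [t [v [ut uv e]]].
have t0 := uniformizer_neq0 curve ut.
have [r [w [uw et]]] := field_factor curve (unifP P) t0.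
(* Write t = unif^r w with w a unit. Then r >= 0 since t is in the stalk, r <= 1 since t divides
   [unif P], and r is nonzero since t is not a unit. *)
have r1 : r = 1.
  have r0 : 0 <= r.
    have := uniformizer_stalk ut; rewrite {1}et.
    by move/(factor_stalk curve (unifP P) _ uw).
  have : stalk P (unif P / t).
    apply/(stalk_max_div curve ut); first exact: uniformizer_stalk (unifP P).
    apply/(stalk_maxE (unifP P)); exists 1; first exact: (subalg1 (sO P)).
    by rewrite mulr1.
  rewrite et invfM mulrA invr_expz -{1}[unif P]expr1z -expfzDr ?unif_neq0 //.
  move/(factor_stalk curve (unifP P) _ (stalk_unitV uw)) => r1.
  have : r != 0.
    apply/eqP => r0'; have := stalk_nonunit ut (subalg1 (sO P)); rewrite mulr1.
    by rewrite et r0' mul1r.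
  lia.
apply: (factor_inj curve (unifP P) _ uu (u := v * w ^ m)).
  apply: stalk_unitM => //; case: (m) => [l|l]; rewrite ?NegzE.
    by elim: l => [|l IH]; [exact: stalk_unit1|rewrite -exprnP exprS; exact: stalk_unitM].
  rewrite -invr_expz; apply: stalk_unitV.
  by elim: (l.+1) => [|l' IH]; [exact: stalk_unit1|rewrite -exprnP exprS; exact: stalk_unitM].
by rewrite e et r1 expr1z exprzMl ?unitfE ?unif_neq0 ?(stalk_unit_neq0 uw) //; ring.
Qed.

Lemma valuationP P f : f != 0 ->
  exists2 u, stalk_unit P u & f = unif P ^ valuation P f * u.
Proof.
move=> f0; have [n [u [uu e]]] := field_factor curve (unifP P) f0.
by exists u => //; rewrite e valuation_factor.
Qed.

Lemma valuation_unit P u : stalk_unit P u -> valuation P u = 0.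
Proof. by move=> uu; rewrite -[u]mul1r -[1](expr0z (unif P)) valuation_factor. Qed.

Lemma point_degreeP P :
  dimq (stalk P : set (restr iota K^o)) (stalk_max P) (point_degree P).
Proof.
have [n hn] := residue_finite curve (unifP P).
by apply: (@xgetPex _ 0%N [set n | has_dim iota (stalk P : set K^o) (stalk_max P) n]); exists n.
Qed.

Lemma point_degree_gt0 P : (0 < point_degree P)%N.
Proof.
apply: (@dimq_pos _ (restr iota K^o) (stalk P) (stalk_max P) _ (1 : K)) (point_degreeP P).
  exact: (subalg1 (sO P)).
by move=> [_]; apply; exact: stalk_unit1.
Qed.

Definition finsupp D : Prop := finite_set [set P | D P != 0].

Definition ddeg D : int := \sum_(P \in [set: point]) D P * (point_degree P)%:Z.

Definition pt P : point -> int := fun Q => (Q == P)%:Z.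

Lemma finsuppP D : finsupp D <-> exists A : {fset point}, forall P, P \notin A -> D P = 0.
Proof.
split=> [/finite_fsetP [A e]|[A h]].
  exists A => P; apply: contraNeq => DP.
  by have : [set P | D P != 0] P by []; rewrite e.
apply: (@sub_finite_set _ _ [set` A]); last exact: finite_fset.
by move=> P /=; apply: contraNT => /h ->.
Qed.

Lemma ddegE D (A : {fset point}) : (forall P, P \notin A -> D P = 0) ->
  ddeg D = \sum_(P <- A) D P * (point_degree P)%:Z.
Proof. by move=> h; rewrite /ddeg (@fsbigTE _ _ _ _ A) // => P /h ->; rewrite mul0r. Qed.

Lemma finsupp_comb a b D D' : finsupp D -> finsupp D' ->
  finsupp (fun P => a * D P + b * D' P) /\
  ddeg (fun P => a * D P + b * D' P) = a * ddeg D + b * ddeg D'.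
Proof.
move=> /finsuppP [A hA] /finsuppP [B hB].
have h D'' : (forall P, P \notin A -> P \notin B -> D'' P = 0) ->
    forall P, P \notin (A `|` B)%fset -> D'' P = 0.
  by move=> h P; rewrite inE negb_or => /andP [] /h; exact.
split; first by apply/finsuppP; exists (A `|` B)%fset; apply: h => P /hA -> /hB ->; rewrite !mulr0.
rewrite !(@ddegE _ (A `|` B)%fset); try apply: h.
- rewrite !mulr_sumr -big_split; apply: eq_bigr => P _ /=; ring.
- by move=> P _ /hB.
- by move=> P /hA.
- by move=> P /hA -> /hB ->; rewrite !mulr0.
Qed.

Lemma finsupp0 : finsupp (fun=> 0) /\ ddeg (fun=> 0) = 0.
Proof.
split; first by apply/finsuppP; exists fset0.
by rewrite (@ddegE _ fset0) // big_seq_fset0.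
Qed.

Lemma finsupp_pt P : finsupp (pt P) /\ ddeg (pt P) = point_degree P.
Proof.
have h Q : Q \notin [fset P]%fset -> pt P Q = 0 by rewrite inE /pt => /negbTE ->.
split; first by apply/finsuppP; exists [fset P]%fset.
by rewrite (ddegE h) big_seq_fset1 /pt eqxx mul1r.
Qed.

Let V := restr iota K^o.
Let VA := restr iota (point -> K^o).

(** The sections of O(D): the pole at P has order at most D(P). *)
Definition LD D : set V := [set f | forall P, stalk P (unif P ^ D P * f)].

Definition AD D : set VA := [set a | forall P, stalk P (unif P ^ D P * a P)].

Definition adeles : set VA := [set a | finite_set [set P | ~ stalk P (a P)]].

(** A(D) + K inside the adeles. The intersection is explicit because it is not yet known that
    elements of K have finitely many poles. *)
Definition AK D : set VA :=
  adeles `&` [set a | exists f : K, forall P, stalk P (unif P ^ D P * (a P - f))].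

Lemma LD_subspace D : subspace (LD D).
Proof.
split=> [P|a u v hu hv P]; first by rewrite mulr0; exact: (subalg0 (sO P)).
rewrite restr_scaleE /GRing.scale /= mulrDr mulrCA; apply: (subalgD (sO P)) => //.
by apply: (subalgM (sO P)) => //; exact: (subalgC (sO P)).
Qed.

Lemma AD_subspace D : subspace (AD D).
Proof.
split=> [P|a u v hu hv P]; first by rewrite mulr0; exact: (subalg0 (sO P)).
rewrite [(_ + _) P](_ : _ = iota a * u P + v P) // mulrDr mulrCA.
apply: (subalgD (sO P)) => //.
by apply: (subalgM (sO P)) => //; exact: (subalgC (sO P)).
Qed.

Lemma adeles_subspace : subspace adeles.
Proof.
split=> [|a u v hu hv].
  apply: (@sub_finite_set _ _ set0) => // P; apply; exact: (subalg0 (sO P)).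
apply: (@sub_finite_set _ _ ([set P | ~ stalk P (u P)] `|` [set P | ~ stalk P (v P)])).
  move=> P /= h; apply/not_andP => -[hu' hv']; apply: h.
  apply: (subalgD (sO P)) => //.
  by apply: (subalgM (sO P)) => //; exact: (subalgC (sO P)).
by rewrite finite_setU.
Qed.

Lemma AK_subspace D : subspace (AK D).
Proof.
apply: subspaceI; first exact: adeles_subspace.
split=> [|a u v [f hf] [f' hf']].
  by exists 0 => P; rewrite subrr mulr0; exact: (subalg0 (sO P)).
exists (iota a * f + f') => P.
rewrite [(_ + _) P](_ : _ = iota a * u P + v P) //.
have -> (t x y : K) : t * (iota a * x + y - (iota a * f + f')) =
    iota a * (t * (x - f)) + t * (y - f') by ring.
apply: (subalgD (sO P)) => //.
by apply: (subalgM (sO P)) => //; exact: (subalgC (sO P)).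
Qed.

Lemma AD_adeles D : finsupp D -> AD D `<=` adeles.
Proof.
move=> fD a ha; apply: sub_finite_set fD => P /=; apply: contra_notN => /eqP DP.
by have := ha P; rewrite DP expr0z mul1r.
Qed.

Let addpt D P : point -> int := fun Q => D Q + pt P Q.

Let addpt_other D P Q : Q != P -> addpt D P Q = D Q.
Proof. by rewrite /addpt /pt => /negbTE ->; rewrite addr0. Qed.
Let addpt_same D P : addpt D P P = D P + 1.
Proof. by rewrite /addpt /pt eqxx. Qed.
Let addpt_ge D P Q : D Q <= addpt D P Q.
Proof. by rewrite /addpt /pt; case: eqP => _; lia. Qed.

(** Only the component at P matters, and multiplying it by t^(D(P) + 1) identifies the quotient with
    the residue field of P. *)
Lemma AD_addpt D P : dimq (AD (addpt D P)) (AD D) (point_degree P).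
Proof.
pose phi (x : V) : VA := fun Q => if Q == P then unif P ^ (- (D P + 1)) * x else 0.
have t0 := unif_neq0 P.
apply: (dimq_iso (phi := phi)) (point_degreeP P).
- move=> a u v; apply/funext => Q; rewrite /phi.
  rewrite [RHS](_ : _ = iota a * (if Q == P then unif P ^ (- (D P + 1)) * u else 0) +
    (if Q == P then unif P ^ (- (D P + 1)) * v else 0)) //.
  case: eqP => _; last by rewrite mulr0 addr0.
  by rewrite restr_scaleE /GRing.scale /=; ring.
- exact: stalk_subspace.
- exact: AD_subspace.
- move=> x Ox Q; rewrite /phi; case: eqVneq => [->|_]; last by rewrite mulr0; exact: (subalg0 (sO Q)).
  by rewrite addpt_same mulrA -expfzDr // subrr expr0z mul1r.
- move=> x Ox; rewrite (stalk_max_div curve (unifP P) Ox).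
  have E : unif P ^ D P * (unif P ^ (- (D P + 1)) * x) = x / unif P.
    by rewrite mulrA -expfzDr // opprD addrA subrr add0r exprN1 mulrC.
  split=> [h Q|/(_ P)]; rewrite /phi ?eqxx ?E //.
  by case: eqVneq => [->|_]; rewrite ?E // mulr0; exact: (subalg0 (sO Q)).
- move=> a ha; exists (unif P ^ (D P + 1) * a P); first by have := ha P; rewrite addpt_same.
  move=> Q; rewrite [(_ - _) Q](_ : _ = a Q - phi (unif P ^ (D P + 1) * a P) Q) // /phi.
  case: eqVneq => [->|QP]; last by have := ha Q; rewrite addpt_other // subr0.
  rewrite mulrA -expfzDr // addNr expr0z mul1r subrr mulr0; exact: (subalg0 (sO P)).
Qed.

(* The exact sequence
   0 -> L(D) -> L(D+P) -> A(D+P)/A(D) -> A/(A(D)+K) -> A/(A(D+P)+K) -> 0 *)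
Lemma addpt_exact D P : finsupp D ->
  exists a b, [/\ dimq (LD (addpt D P)) (LD D) a,
    dimq (AK (addpt D P)) (AK D) b & (a + b = point_degree P)%N].
Proof.
move=> fD.
have fD' : finsupp (addpt D P).
  have [+ _] := finsupp_comb 1 1 fD (finsupp_pt P).1.
  by congr finsupp; apply/funext => Q; rewrite !mul1r.
have sub : AD D `<=` AD (addpt D P) by move=> a ha Q; exact: stalk_unif_ge (ha Q).
have sub' : AK D `<=` AK (addpt D P).
  by move=> a [Aa [f hf]]; split=> //; exists f => Q; exact: stalk_unif_ge (hf Q).
have AK_AD D1 : finsupp D1 -> AD D1 `<=` AK D1.
  move=> fD1 a ha; split; first exact: AD_adeles ha.
  by exists 0 => Q; rewrite subr0.
(* The kernel of A(D+P) -> A / (A(D) + K). It cuts A(D+P) / A(D) into T / A(D), which is L(D+P) /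
   L(D), and A(D+P) / T, which is the kernel of the last map of the sequence. *)
pose T := AD (addpt D P) `&` AK D.
have sT : subspace T by apply: subspaceI; [exact: AD_subspace|exact: AK_subspace].
have [a [b [ha hb e]]] := dimq_split (AD_subspace (addpt D P)) sT (AD_subspace D)
  (fun x h => conj (sub _ h) (AK_AD _ fD _ h)) (fun _ h => h.1) (AD_addpt D P).
exists a, b; split=> //; last first.
  apply: (dimq_iso (phi := id)) hb => //.
  - exact: AD_subspace.
  - exact: AK_subspace.
  - exact: AK_AD.
  - by move=> x hx; split=> [[]|].
  - move=> x [Ax [f hf]]; exists (fun Q => x Q - f) => //.
    (* The constant family f is an adele only as a difference of two adeles. *)
    have Axf : adeles (fun Q => x Q - f) by apply: (AD_adeles fD').
    have Af : adeles (fun=> f).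
      have := subspaceB adeles_subspace Ax Axf.
      congr adeles; apply/funext => Q.
      by rewrite [LHS](_ : _ = x Q - (x Q - f)) // subKr.
    rewrite [X in AK D X](_ : _ = (fun=> f)); last first.
      by apply/funext => Q; rewrite [LHS](_ : _ = x Q - (x Q - f)) // subKr.
    split=> //; exists f => Q; rewrite subrr mulr0; exact: (subalg0 (sO Q)).
pose phi (f : V) : VA := fun=> f.
apply: (dimq_iso_inv (phi := phi)) ha => //.
- exact: LD_subspace.
- exact: AD_subspace.
- move=> f hf; split=> //; split; first exact: (AD_adeles fD').
  by exists f => Q; rewrite subrr mulr0; exact: (subalg0 (sO Q)).
- move=> x [hx [Ax [f hf]]]; exists f => // Q.
  rewrite -[f](subKr (x Q)) mulrBr; apply: (subalgB (sO Q)) => //.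
  exact: stalk_unif_ge (hf Q).
Qed.

Variables (g : nat) (hg : has_genus C g).

Lemma LD0_const (f : K) : LD (fun=> 0) f -> exists c, f = iota c.
Proof.
move=> h; apply: algebraic_const; first exact: curve_smooth.
apply: (global_algebraic curve) => P.
by have := h P; rewrite expr0z mul1r.
Qed.

Lemma LD0_dim : dimq (LD (fun=> 0)) [set 0] 1.
Proof.
exists (fun=> 1 : K); split=> [_ P|f /LD0_const [c ->]].
  by rewrite expr0z mul1r; exact: (subalg1 (sO P)).
have E (c' : 'rV[k]_1) :
    \sum_(i < 1) c' ord0 i *: ((1 : K) : V) = iota (c' ord0 ord0).
  by rewrite big_ord1 restr_scaleE /GRing.scale /= mulr1.
exists (const_mx c); split=> [|c']; first by rewrite E mxE /= subrr.
rewrite E /= => /subr0_eq /fmorph_inj ->.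
by apply/rowP => i; rewrite mxE (ord1 i).
Qed.

Lemma AK0_dim : dimq adeles (AK (fun=> 0)) g.
Proof.
have := hg; rewrite /has_genus has_dimE; apply: dimq_eq; first exact: adeles_subspace.
move=> a Aa; split=> [[f hf]|[_ [f hf]]].
  by split=> //; exists f => P; rewrite expr0z mul1r.
by exists f => P; have := hf P; rewrite expr0z mul1r.
Qed.

(** Here h1 is the dimension of H^1(O(D)), realised as adeles modulo A(D) + K. *)
Definition riemann_roch D : Prop :=
  exists h h1 : nat, [/\ dimq (LD D) [set 0] h, dimq adeles (AK D) h1
    & h%:Z - h1%:Z = ddeg D + 1 - g%:Z].

Lemma subset_set0 D : [set (0 : V)] `<=` LD D.
Proof. by move=> _ ->; exact: subspace0 (LD_subspace D). Qed.

Lemma AK_adeles D : AK D `<=` adeles. Proof. by move=> a []. Qed.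

(** Passing to D + P raises h by a and lowers h1 by b, with a + b = deg P. The converse serves to
    subtract points. *)
Lemma riemann_roch_addpt D P : finsupp D ->
  riemann_roch D <-> riemann_roch (addpt D P).
Proof.
move=> fD; have [a [b [ha hb e]]] := addpt_exact P fD.
have eD : ddeg (addpt D P) = ddeg D + (point_degree P)%:Z.
  have [_ ] := finsupp_comb 1 1 fD (finsupp_pt P).1.
  rewrite (finsupp_pt P).2 !mul1r => <-; congr ddeg.
  by apply/funext => Q; rewrite !mul1r.
have LL : LD D `<=` LD (addpt D P) by move=> f hf Q; exact: stalk_unif_ge (hf Q).
have KK : AK D `<=` AK (addpt D P).
  by move=> x [Ax [f hf]]; split=> //; exists f => Q; exact: stalk_unif_ge (hf Q).
split=> -[h [h1 [hh hh1 er]]].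
  have [b' [h1' [hb' hh1' e1]]] := dimq_split adeles_subspace
    (AK_subspace (addpt D P)) (AK_subspace D) KK (@AK_adeles _) hh1.
  exists (h + a)%N, h1'; split=> //.
    exact: (dimq_add (LD_subspace _) (LD_subspace D) (subspace_set0 _)
      (@subset_set0 _) LL).
  have := dimq_inj (AK_subspace _) (AK_subspace _) hb hb'; lia.
have [h' [a' [hh' ha' e1]]] := dimq_split (LD_subspace (addpt D P)) (LD_subspace D)
  (subspace_set0 _) (@subset_set0 _) LL hh.
exists h', (b + h1)%N; split=> //.
  exact: (dimq_add adeles_subspace (AK_subspace (addpt D P)) (AK_subspace D)
    KK (@AK_adeles _)).
have := dimq_inj (LD_subspace _) (LD_subspace _) ha ha'; lia.
Qed.

Lemma riemann_roch_addmul D P (n : int) : finsupp D -> riemann_roch D ->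
  riemann_roch (fun Q => D Q + n * pt P Q).
Proof.
move=> fD rD.
have fn (m : int) : finsupp (fun Q => D Q + m * pt P Q).
  have [+ _] := finsupp_comb 1 m fD (finsupp_pt P).1.
  by congr finsupp; apply/funext => Q; rewrite mul1r.
elim/int_rec: n => [|n IHn|n IHn].
- by rewrite (_ : (fun Q => _) = D) //; apply/funext => Q; rewrite mul0r addr0.
- have /(riemann_roch_addpt P (fn n)) := IHn.
  congr riemann_roch; apply/funext => Q; rewrite /addpt -addn1 PoszD; ring.
- apply/(riemann_roch_addpt P (fn _)); move: IHn.
  congr riemann_roch; apply/funext => Q; rewrite /addpt -addn1 PoszD; ring.
Qed.

(** Start from D = 0, where h = 1 because global functions are constant and h1 = g by definition,
    and add the points of the support one by one with their multiplicities. *)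
Theorem riemann_rochP D : finsupp D -> riemann_roch D.
Proof.
move=> /finsuppP [A hA].
pose Ds (s : seq point) Q := \sum_(P <- s) D P * pt P Q.
have fDs s : finsupp (Ds s).
  elim: s => [|P s IHs].
    by rewrite (_ : Ds [::] = fun=> 0); [exact: finsupp0.1|apply/funext => Q; rewrite /Ds big_nil].
  have [+ _] := finsupp_comb 1 (D P) IHs (finsupp_pt P).1.
  by congr finsupp; apply/funext => Q; rewrite /Ds big_cons mul1r addrC.
have -> : D = Ds A.
  apply/funext => Q; rewrite /Ds; have [QA|QA] := boolP (Q \in A); last first.
    rewrite (hA _ QA) big1_seq // => P /andP [_ PA]; rewrite /pt.
    by case: eqP => [e|_]; rewrite ?mulr0 // -e in PA *; rewrite PA in QA.
  rewrite (bigD1_seq Q) ?fset_uniq //= /pt eqxx mulr1 big1 ?addr0 // => P PQ.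
  by rewrite eq_sym (negbTE PQ) mulr0.
elim: (A : seq point) => [|P s IHs].
  rewrite (_ : Ds [::] = fun=> 0); last by apply/funext => Q; rewrite /Ds big_nil.
  exists 1%N, g; split; [exact: LD0_dim|exact: AK0_dim|].
  by rewrite finsupp0.2 add0r.
have := riemann_roch_addmul P (D P) (fDs s) IHs.
by congr riemann_roch; apply/funext => Q; rewrite /Ds big_cons addrC.
Qed.

Lemma LD_mul D D' f f' : LD D f -> LD D' f' -> LD (fun P => D P + D' P) ((f : K) * f').
Proof.
move=> hf hf' P; rewrite expfzDr ?unif_neq0 //.
rewrite (_ : _ * _ * _ = (unif P ^ D P * f) * (unif P ^ D' P * f')); last first.
  by rewrite [in RHS]mulrACA.
exact: (subalgM (sO P)).
Qed.

Lemma LD_exp D f n : LD D f -> LD (fun P => n%:Z * D P) ((f : K) ^+ n).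
Proof.
move=> hf; elim: n => [|n IHn] P.
  by rewrite mul0r expr0z mul1r; exact: (subalg1 (sO P)).
by rewrite exprS; have := LD_mul hf IHn P; congr (stalk P (_ ^ _ * _)); rewrite -addn1 PoszD; ring.
Qed.

(* Multiplication by f^m embeds L(-mD) into L(0). *)
Lemma LD_deg_ge0 D f : finsupp D -> LD D f -> f != 0 -> 0 <= ddeg D.
Proof.
(* If deg D < 0, then h(-mD) >= m + 1 - g = 2, too large for a subspace of the one-dimensional
   L(0). *)
move=> fD hf f0; pose m := g.+1.
have [fmD eD] := finsupp_comb (- m%:Z) 0 fD fD.
have [h [h1 [hh _ er]]] := riemann_rochP fmD.
pose phi (x : V) : V := (f : K) ^+ m * x.
have lphi : linear phi.
  by move=> a u v; rewrite /phi !restr_scaleE /GRing.scale /= mulrDr mulrCA.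
have [a [b [ha hb e]]] := dimq_image lphi (LD_subspace _) hh.
have a0 : a = 0%N.
  apply: (dimq_inj _ (subspace_set0 V) ha); last apply: dimq0.
    apply: subspaceI; first exact: LD_subspace.
    exact: (subspace_preim lphi (subspace_set0 V)).
  move=> x [_ /eqP]; rewrite /phi mulf_eq0 expf_eq0 (negbTE f0) andbF /= => /eqP; exact.
have : (b <= 1)%N.
  apply: dimq_sub (subspace_set0 V) _ _ LD0_dim hb.
  - exact: LD_subspace.
  - by apply: subspace_img => //; exact: LD_subspace.
  - by move=> _ ->; exists 0; [exact: subspace0 (LD_subspace _)|rewrite /phi mulr0].
  - move=> _ [x hx <-] P.
    have := LD_mul (LD_exp m hf) hx P; congr (stalk P (_ ^ _ * _)); ring.
have {er} : h%:Z >= - (m%:Z * ddeg D) + 1 - g%:Z by rewrite eD in er; lia.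
rewrite /m; nia.
Qed.

(** If f vanished on a set B of more than deg D points off the support of D, it would be a nonzero
    section of D - B, whose degree is negative. *)
Lemma finite_zeros D f : finsupp D -> LD D f -> f != 0 -> adeles (fun=> (f : K)^-1).
Proof.
move=> fD hf f0; have d0 := LD_deg_ge0 fD hf f0.
pose Z := [set P | D P = 0 /\ ~ stalk P (f : K)^-1].
apply: (@sub_finite_set _ _ ([set P | D P != 0] `|` Z)).
  by move=> P /= h; have [e|e] := eqVneq (D P) 0; [right|left].
rewrite finite_setU; split=> //; apply: contrapT => infZ.
have [B BZ cB] := infinite_set_fset `|ddeg D|.+1 infZ.
pose E Q := \sum_(P <- B) pt P Q.
have EE Q : E Q = (Q \in B)%:Z.
  rewrite /E; have [QB|QB] := boolP (Q \in B).
    rewrite (bigD1_seq Q) ?fset_uniq //= /pt eqxx big1 ?addr0 // => P PQ.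
    by rewrite eq_sym (negbTE PQ).
  rewrite big1_seq // => P /andP [_ PB]; rewrite /pt.
  by case: eqP => // e; rewrite e PB in QB.
have hE P : P \notin B -> E P = 0 by rewrite EE => /negbTE ->.
have fE : finsupp E by apply/finsuppP; exists B.
have dE : `|ddeg D|.+1%:Z <= ddeg E.
  rewrite (ddegE hE); apply: (@le_trans _ _ (\sum_(P <- B) 1)).
    rewrite big_const_seq count_predT iter_addr_0 -[1]/(1%:Z) natz; move: cB.
    by rewrite cardfE -cardfE => ?; lia.
  rewrite big_seq [leRHS]big_seq; apply: ler_sum => P PB.
  by rewrite EE PB mul1r; have := point_degree_gt0 P; lia.
have [fDE eDE] := finsupp_comb 1 (-1) fD fE.
suff hf' : LD (fun P => 1 * D P + (-1) * E P) f by have := LD_deg_ge0 fDE hf' f0; lia.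
move=> P; have := hf P; rewrite mul1r EE; have [PB|_] := boolP (P \in B); last first.
  by rewrite mulr0 addr0.
have [DP nP] := BZ P PB; rewrite DP add0r mulr1 expr0z mul1r => Of.
rewrite exprN1 mulrC; apply/(stalk_max_div curve (unifP P)) => //; split=> //.
by move=> /stalk_unitE [].
Qed.

Lemma adeles_mul a b : adeles a -> adeles b -> adeles (fun P => (a P : K) * b P).
Proof.
move=> ha hb.
apply: (@sub_finite_set _ _ ([set P | ~ stalk P (a P)] `|` [set P | ~ stalk P (b P)])).
  move=> P /= h; apply/not_andP => -[ha' hb']; apply: h.
  exact: (subalgM (sO P)).
by rewrite finite_setU.
Qed.

(** The g adeles representing a basis of H^1(O) have finitely many poles in all, so one D bounds
    them and absorbs the whole of H^1. *)
Lemma exists_nonspecial : exists2 D, finsupp D & adeles `<=` AK D.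
Proof.
have [b [Ab hb]] := AK0_dim.
have /choice [N hN] : forall P, exists N : nat, forall i, stalk P (unif P ^ N%:Z * (b i P)).
  move=> P; have /choice [N hN] := fun i => field_denominator curve (unifP P) (b i P).
  exists (\max_i N i) => i; apply: stalk_unif_ge (hN i); rewrite lez_nat.
  exact: leq_bigmax.
pose S := \bigcup_(i in [set: 'I_g]) [set P | ~ stalk P (b i P)].
have fS : finite_set S by apply: bigcup_finite => // i _; exact: Ab.
pose D P : int := if `[< S P >] then (N P)%:Z else 0.
have fD : finsupp D.
  apply: sub_finite_set fS => P /=; rewrite /D.
  by case: asboolP.
have D0 P : 0 <= D P by rewrite /D; case: ifP.
have bD i : AK D (b i).
  split=> //; exists 0 => P; rewrite subr0 /D; case: asboolP => [_|nS]; first exact: hN.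
  rewrite expr0z mul1r; apply: contrapT => h; apply: nS; by exists i.
exists D => // a /[dup] Aa /hb [c [[_ [f hf]] _]].
rewrite -[a](subrK (\sum_i c ord0 i *: b i)); apply: subspaceD.
- exact: AK_subspace.
- split; last by exists f => P; apply: stalk_unif_ge (hf P).
  apply: subspaceB => //; first exact: adeles_subspace.
  apply: subspace_sum => [|i _]; first exact: adeles_subspace.
  by apply: subspaceZ => //; exact: adeles_subspace.
- apply: subspace_sum => [|i _]; first exact: AK_subspace.
  by apply: subspaceZ => //; exact: AK_subspace.
Qed.

(* If f is a nonzero element of L(D - D0), then f A(D0) is contained in A(D). *)
Theorem riemann_roch_large : exists d0 : int, forall D, finsupp D -> d0 <= ddeg D ->
  exists2 h : nat, dimq (LD D) [set 0] h & h%:Z = ddeg D + 1 - g%:Z.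
Proof.
have [D0 fD0 hD0] := exists_nonspecial.
(* With this bound h(D - D0) >= deg D - deg D0 + 1 - g >= 1, so a nonzero f exists. *)
exists (ddeg D0 + g%:Z) => D fD dD.
have [h [h1 [hh hh1 er]]] := riemann_rochP fD; exists h => //.
suff : h1 = 0%N by move=> e; rewrite e in er; lia.
have [fDD eDD] := finsupp_comb 1 (-1) fD fD0.
have [h' [h1' [hh' _ er']]] := riemann_rochP fDD.
have [f [hf f0]] : exists f, LD (fun P => 1 * D P + -1 * D0 P) f /\ f != 0.
  have h'0 : (0 < h')%N by lia.
  apply: contrapT => nf; suff e : h' = 0%N by rewrite e in h'0.
  apply: (dimq_inj (LD_subspace _) (subspace_set0 V) hh'); apply: dimq0.
  move=> x hx; apply: contrapT => x0; apply: nf; exists x; split=> //; exact/eqP.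
apply: (dimq_inj adeles_subspace (AK_subspace D) hh1).
exists (fun=> 0); split=> [[]//|a Aa]; exists 0; split; last by move=> c _; apply/rowP => -[].
rewrite big_ord0 subr0; split=> //.
(* Decompose a / f in A(D0) + K and multiply back by f. *)
have [_ [x hx]] := hD0 _ (adeles_mul (finite_zeros fDD hf f0) Aa).
exists ((f : K) * x) => P.
have := subalgM (sO P) (hf P) (hx P).
rewrite mulrACA -expfzDr ?unif_neq0 //; congr (stalk P (_ ^ _ * _)); first by ring.
by rewrite mulrBr mulrA divff // mul1r.
Qed.
End RiemannRoch.

(** * Line bundles as divisors *)

Section LineBundles.
Context {k : fieldType} (C : smooth_proj_curve k).
Local Notation K := (funfield C).
Local Notation iota := (scalars C).
Implicit Types (L : line_bundle C).

Definition bundle_div L (P : closed_point C) : int := - valuation P (gen L P).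

Lemma bundle_div_finsupp L : finsupp (bundle_div L).
Proof.
apply: sub_finite_set (gen_finite L) => P /= + uP.
by rewrite /bundle_div valuation_unit.
Qed.

Lemma ddeg_bundle_div L : ddeg (bundle_div L) = degree L.
Proof.
have [A hA] := (finsuppP _).1 (bundle_div_finsupp L).
rewrite (ddegE hA) /degree (@fsbigTE _ _ _ _ A) => [|P /hA /eqP]; last first.
  by rewrite oppr_eq0 => /eqP ->; rewrite mul0r.
by rewrite -sumrN; apply: eq_bigr => P _; rewrite mulNr.
Qed.

Lemma sectionsE L e : sections L e = LD (fun P => e%:Z * bundle_div L P).
Proof.
have sO P : subalg iota (stalk P) := stalk_subalg P.
(* The generators [gen L P ^+ e] and [unif P ^ (- (e%:Z * bundle_div L P))] differ by a unit, so
   they impose the same condition on f. *)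
have key P : exists2 u, stalk_unit P u &
    unif P ^ (e%:Z * bundle_div L P) * gen L P ^+ e = u ^+ e.
  have [u uu eg] := valuationP P (gen_neq0 L P); exists u => //.
  rewrite {1}eg exprMn mulrA /bundle_div [(unif P ^ _) ^+ e]exprnP exprz_exp.
  rewrite -expfzDr ?unif_neq0 // (_ : _ + _ = 0) ?expr0z ?mul1r //; ring.
apply/seteqP; split=> f hf P; have [u uu eu] := key P.
  have [a Oa ->] := hf P; rewrite mulrA eu.
  by apply: (subalgM (sO P)) => //; apply: (subalgX (sO P)); case: uu.
have /stalk_unitE [Ou Ou' u0] := uu.
exists (u ^- e * (unif P ^ (e%:Z * bundle_div L P) * f)).
  by apply: (subalgM (sO P)) => //; rewrite -exprVn; exact: (subalgX (sO P)).
have -> (a b c : K) : a * (b * (c * f)) = (c * a) * b * f by ring.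
by rewrite eu divff ?mul1r // expf_neq0.
Qed.

Lemma sections_subspace L e : subspace (sections L e : set (restr iota K^o)).
Proof. by rewrite sectionsE; exact: LD_subspace. Qed.

Lemma sections0_dim L :
  dimq (sections L 0 : set (restr iota K^o)) [set 0] 1.
Proof.
rewrite sectionsE (_ : (fun P => _) = fun=> 0); first exact: LD0_dim.
by apply/funext => P; rewrite mul0r.
Qed.

Lemma h0_eq L h : dimq (sections L 1 : set (restr iota K^o)) [set 0] h -> h0 L = h.
Proof.
move=> hh; apply: xget_unique; first by [].
move=> h' hh'; apply: (@dimq_inj _ (restr iota K^o) (sections L 1) [set 0] _ _ _ _ hh' hh).
  exact: sections_subspace.
exact: subspace_set0.
Qed.

Lemma sections_dim_large (g : nat) : has_genus C g -> exists d0 : int,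
  forall L, d0 <= degree L ->
    (h0 L)%:Z = degree L + 1 - g%:Z /\
    forall e, (0 < e)%N -> exists2 h : nat,
      dimq (sections L e : set (restr iota K^o)) [set 0] h &
      h%:Z = e%:Z * degree L + 1 - g%:Z.
Proof.
move=> hg; have [d0 hd] := riemann_roch_large hg.
(* The absolute value makes the degree nonnegative, so that e deg L >= deg L >= d0 for e >= 1. *)
exists `|d0|%:Z => L dL.
have h e : (0 < e)%N -> exists2 h : nat,
      dimq (sections L e : set (restr iota K^o)) [set 0] h &
      h%:Z = e%:Z * degree L + 1 - g%:Z.
  move=> e0; have fL := bundle_div_finsupp L.
  have [fD eD] := finsupp_comb e%:Z 0 fL fL.
  have E : (fun P => e%:Z * bundle_div L P + 0 * bundle_div L P) =
      (fun P => e%:Z * bundle_div L P).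
    by apply/funext => P; rewrite mul0r addr0.
  rewrite E mul0r addr0 ddeg_bundle_div in fD eD.
  rewrite sectionsE -eD; apply: hd => //; rewrite eD; nia.
split=> //; have [n hn en] := h 1%N isT.
by rewrite (h0_eq hn) en mul1r.
Qed.
End LineBundles.

(** * Euler characteristics of graded complexes *)

Lemma dimq_seq (k : fieldType) (V : lmodType k) (T : eqType) (r : seq T)
    (b : T -> V) (coord : V -> T -> k) (U : set V) : uniq r ->
  (forall x, linear_for *%R (coord^~ x)) ->
  (forall x y, coord (b x) y = (x == y)%:R) ->
  (forall x, x \in r -> U (b x)) ->
  (forall v, U v -> v = \sum_(x <- r) coord v x *: b x) ->
  dimq U [set 0] (size r).
Proof.
move=> ur lc cb Ub hU; pose x i := tnth (in_tuple r) i.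
have xinj : injective x by apply/(tuple_uniqP (in_tuple r)).
exists (fun i => b (x i)); split=> [i|v Uv]; first by apply: Ub; exact: mem_tnth.
have E (c : 'rV[k]_(size r)) j : coord (\sum_i c ord0 i *: b (x i)) (x j) = c ord0 j.
  pose phi : {linear V -> k^o} := HB.pack (coord^~ (x j))
    (GRing.isLinear.Build k V k^o *:%R (coord^~ (x j)) (lc (x j))).
  rewrite -[LHS]/(phi _) linear_sum (bigD1 j) // linearZ /= cb eqxx big1 ?addr0.
    by rewrite /GRing.scale /= mulr1.
  move=> i ij; rewrite -[coord _ _]/(phi _) linearZ /= cb (inj_eq xinj) (negbTE ij).
  by rewrite scaler0.
exists (\row_j coord v (x j)); split=> [|c /subr0_eq e].
  apply/eqP; rewrite subr_eq0; apply/eqP; rewrite [LHS](hU v Uv) big_tnth.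
  by apply: eq_bigr => i _; rewrite mxE.
by apply/rowP => j; rewrite mxE e E.
Qed.

Lemma euler_char (k : fieldType) (V : nat -> lmodType k)
    (d : forall p, V p.+1 -> V p) (U : forall p, set (V p)) (a h : nat -> nat) (l : nat) :
  (forall p, linear (d p)) -> (forall p, subspace (U p)) ->
  (forall p v, U p.+1 v -> U p (d p v)) ->
  (forall p v, U p.+2 v -> d p (d p.+1 v) = 0) ->
  (forall p, dimq (U p) [set 0] (a p)) ->
  dimq (U 0%N) [set d 0%N v | v in U 1%N] (h 0%N) ->
  (forall p, dimq (U p.+1 `&` [set v | d p v = 0])
     [set d p.+1 v | v in U p.+2] (h p.+1)) ->
  (forall p, (l <= p)%N -> a p = 0%N) ->
  \sum_(p < l) (-1) ^+ p * (a p)%:Z = \sum_(p < l) (-1) ^+ p * (h p)%:Z.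
Proof.
move=> ld sU dU dd aU h0 hp al.
have sI p : subspace [set d p v | v in U p.+1] by exact: subspace_img.
have sK p : subspace (U p.+1 `&` [set v | d p v = 0]).
  by apply: subspaceI => //; exact: (subspace_preim (ld p) (subspace_set0 _)).
have zS p (A : set (V p)) : subspace A -> [set 0] `<=` A by move=> sA _ ->; case: sA.
have /choice [b hb] : forall p, exists b, dimq [set d p v | v in U p.+1] [set 0] b /\
    exists2 z, dimq (U p.+1 `&` [set v | d p v = 0]) [set 0] z & (z + b = a p.+1)%N.
  move=> p; have [z [b [hz hb e]]] := dimq_image (ld p) (sU _) (aU p.+1).
  by exists b; split=> //; exists z.
have a0 : a 0%N = (b 0%N + h 0%N)%N.
  have := dimq_add (sU 0%N) (sI 0%N) (subspace_set0 _) (zS _ _ (sI 0%N)).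
  move=> /(_ _ _ _ (hb 0%N).1 h0) e.
  apply: (dimq_inj (sU 0%N) (subspace_set0 _) (aU 0%N)); apply: e.
  by move=> _ [v Uv <-]; exact: dU.
have aS p : a p.+1 = (b p.+1 + h p.+1 + b p)%N.
  have [_ [z hz <-]] := hb p; congr (_ + _)%N.
  apply: (dimq_inj (sK p) (subspace_set0 _) hz).
  apply: (dimq_add _ _ _ _ _ (hb p.+1).1 (hp p)) => //.
  - exact: subspace_set0.
  - exact: zS.
  - by move=> _ [v Uv <-]; split; [exact: dU|exact: dd].
apply/eqP; rewrite -subr_eq0 -sumrB; apply/eqP.
case: l al => [|l] al; first by rewrite big_ord0.
(* The truncated difference telescopes to the rank [b n] of the differential entering place n;
   beyond the length of the complex that rank is zero. *)
have E n : \sum_(p < n.+1) ((-1) ^+ p * (a p)%:Z - (-1) ^+ p * (h p)%:Z) =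
    (-1) ^+ n * (b n)%:Z :> int.
  elim: n => [|n IHn]; first by rewrite big_ord1 a0 PoszD; ring.
  by rewrite big_ord_recr /= IHn aS !PoszD exprS; ring.
rewrite E; have := al l.+1 (leqnn _); rewrite aS => e.
by rewrite (_ : b l = 0%N) ?mulr0 //; lia.
Qed.

(** Empty in negative degree, so that twists S(-q) are counted correctly below their generator. *)
Definition monos (N : nat) (z : int) : seq 'X_{1..N} :=
  match z with
  | Posz d => [seq s2m (val t) | t <- enum (basis N d)]
  | Negz _ => [::]
  end.

Lemma mem_monos N z m : (m \in monos N z) = ((mdeg m)%:Z == z).
Proof. by case: z => d //=; rewrite -basis_cover. Qed.

Lemma uniq_monos N z : uniq (monos N z).
Proof. by case: z => d //=; exact: uniq_basis. Qed.

Lemma size_monos n d : size (monos n.+1 (Posz d)) = 'C(d + n, d).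
Proof. exact: size_basis. Qed.

Lemma mcoeffM_neq0 (R : comNzRingType) N (p q : {mpoly R[N]}) m : (p * q)@_m != 0 ->
  exists m1 m2, [/\ p@_m1 != 0, q@_m2 != 0 & m = (m1 + m2)%MM].
Proof.
rewrite -mcoeff_msupp => /msuppM_le /allpairsP [[m1 m2] /= [h1 h2 ->]].
by exists m1, m2; rewrite -!mcoeff_msupp.
Qed.

Lemma sum_neq0 (R : zmodType) (I : finType) (F : I -> R) :
  \sum_i F i != 0 -> exists i, F i != 0.
Proof.
move=> h; apply/existsP; apply: contraNT h; rewrite negb_exists => /forallP h.
by rewrite big1 // => i _; apply/eqP; rewrite -[_ == _]negbK h.
Qed.

Section Strands.
Context {k : fieldType} (N : nat).
Local Notation S := {mpoly k[N]}.

Definition mvec n := restr (@mpolyC N k) 'rV[S]_n.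

(** A predicate on degrees, rather than one degree, so that the degree e part and its complement are
    instances of one construction. *)
Definition strand n (dg : 'I_n -> int) (Q : int -> Prop) : set (mvec n) :=
  [set v : 'rV[S]_n | forall j m, (v ord0 j)@_m != 0 -> Q (dg j + (mdeg m)%:Z)].

Lemma mvec_coeff n (a : k) (u v : mvec n) j m :
  (((a *: u + v : mvec n) : 'rV[S]_n) ord0 j)@_m =
  a * ((u : 'rV[S]_n) ord0 j)@_m + ((v : 'rV[S]_n) ord0 j)@_m.
Proof. by rewrite restr_scaleE !mxE mcoeffD mcoeffCM. Qed.

Lemma strand_subspace n (dg : 'I_n -> int) Q : subspace (strand dg Q).
Proof.
split=> [j m|a u v hu hv j m]; first by rewrite mxE mcoeff0 eqxx.
rewrite mvec_coeff => h.
have [e|e] := eqVneq (((u : 'rV[S]_n) ord0 j)@_m) 0; last exact: hu.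
by apply: hv; rewrite e mulr0 add0r in h.
Qed.

Lemma strand_dim n (dg : 'I_n -> int) (e : int) :
  dimq (strand dg (eq^~ e)) [set 0] (\sum_(j < n) size (monos N (e - dg j))).
Proof.
pose r := [seq (j, m) | j <- enum 'I_n, m <- monos N (e - dg j)].
have memr j m : ((j, m) \in r) = (dg j + (mdeg m)%:Z == e).
  apply/allpairsPdep/idP => [[j' [m' [_ + [-> ->]]]]|h].
    by rewrite mem_monos => /eqP ->; rewrite addrC subrK.
  by exists j, m; rewrite mem_enum mem_monos -(eqP h) addrAC subrr add0r.
have -> : (\sum_(j < n) size (monos N (e - dg j)))%N = size r.
  by rewrite size_allpairs_dep sumnE big_map big_enum.
pose b (x : 'I_n * 'X_{1..N}) : mvec n := \row_j if j == x.1 then 'X_[x.2] else 0.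
pose coord (v : mvec n) (x : 'I_n * 'X_{1..N}) := ((v : 'rV[S]_n) ord0 x.1)@_x.2.
have cb x y : coord (b x) y = (x == y)%:R.
  case: x y => [j m] [j' m']; rewrite /coord /b mxE /= xpair_eqE eq_sym.
  by case: eqP => _ /=; rewrite ?mcoeffX ?mcoeff0.
have lc x : linear_for *%R (coord^~ x) by move=> a u v; exact: mvec_coeff.
apply: (dimq_seq (b := b) (coord := coord)) => //.
- apply: allpairs_uniq_dep; first exact: enum_uniq.
    by move=> j _; exact: uniq_monos.
  by move=> [? ?] [? ?] _ _ /= [-> ->].
- move=> [j m]; rewrite memr => /eqP e0 j' m' h.
  have : coord (b (j, m)) (j', m') != 0 by [].
  by rewrite cb; case: (eqVneq (j, m) (j', m')) => [[<- <-]|_]; rewrite ?eqxx.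
- move=> v hv; apply/rowP => j; apply/mpolyP => m.
  pose phi : {linear mvec n -> k^o} := HB.pack (coord^~ (j, m))
    (GRing.isLinear.Build k (mvec n) k^o *:%R (coord^~ (j, m)) (lc (j, m))).
  rewrite -[LHS]/(phi v) -[RHS]/(phi _) linear_sum.
  under eq_bigr => x _ do rewrite linearZ /= cb /GRing.scale /=.
  have [jm|jm] := boolP ((j, m) \in r).
    rewrite (bigD1_seq (j, m)) //=; last first.
      apply: allpairs_uniq_dep; first exact: enum_uniq.
        by move=> j' _; exact: uniq_monos.
      by move=> [? ?] [? ?] _ _ /= [-> ->].
    by rewrite eqxx mulr1 big1 ?addr0 // => x /negbTE ->; rewrite mulr0.
  rewrite big1_seq => [|x /andP [_ xr]].
    by apply/eqP; apply: contraNT jm => /hv h; rewrite memr h.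
  by case: eqP => [e0|_]; rewrite ?mulr0 //; rewrite e0 (negbTE jm) in xr.
Qed.

Lemma strand_split n (dg : 'I_n -> int) (e : int) (v : mvec n) :
  exists v1 v2, [/\ strand dg (eq^~ e) v1, strand dg (fun z => z <> e) v2 & v = v1 + v2].
Proof.
pose hp (z : int) (f : S) : S := \sum_(m <- msupp f | (mdeg m)%:Z == z) f@_m *: 'X_[m].
have hpE z f m : (hp z f)@_m = if (mdeg m)%:Z == z then f@_m else 0.
  rewrite raddf_sum /=; under eq_bigr do rewrite mcoeffZ mcoeffX.
  case: ifP => mz; last first.
    rewrite big1 // => m' /eqP mz'; case: eqP => [e0|]; rewrite ?mulr0 //.
    by rewrite -e0 mz' eqxx in mz.
  have [mf|mf] := boolP (m \in msupp f).
    rewrite big_mkcond (bigD1_seq m) ?msupp_uniq //= mz eqxx mulr1 big1 ?addr0 //.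
    by move=> m' /negbTE ->; rewrite mulr0; case: ifP.
  rewrite (memN_msupp_eq0 mf) big1_seq // => m' /andP [_ m'f].
  by case: eqP => [e0|]; rewrite ?mulr0 // -e0 m'f in mf *.
pose v1 : mvec n := \row_j hp (e - dg j) ((v : 'rV[S]_n) ord0 j).
exists v1, (v - v1); split.
- move=> j m; rewrite mxE hpE; case: ((mdeg m)%:Z =P e - dg j) => [->|_ /eqP] // _.
  by rewrite addrC subrK.
- move=> j m; rewrite !mxE mcoeffB hpE; case: ((mdeg m)%:Z =P e - dg j) => [_|h _].
    by rewrite subrr eqxx.
  by move=> h'; apply: h; rewrite -h'; ring.
- by rewrite addrC subrK.
Qed.

Lemma strand_mul n n' (dg : 'I_n -> int) (dg' : 'I_n' -> int) (M : 'M[S]_(n, n'))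
    Q (v : 'rV[S]_n) :
  (forall i j m, (M i j)@_m != 0 -> dg i = dg' j + (mdeg m)%:Z) ->
  strand dg Q v -> strand dg' Q (v *m M).
Proof.
move=> hM hv j m; rewrite mxE raddf_sum => /sum_neq0 [i].
move=> /mcoeffM_neq0 [m1 [m2 [h1 h2 ->]]].
have := hv i m1 h1; rewrite (hM _ _ _ h2); congr Q.
rewrite mdegD PoszD; ring.
Qed.

Lemma strand_disjoint n (dg : 'I_n -> int) (e : int) (v : 'rV[S]_n) :
  strand dg (eq^~ e) v -> strand dg (fun z => z <> e) v -> v = 0.
Proof.
move=> h1 h2; apply/rowP => j; apply/mpolyP => m; rewrite mxE mcoeff0; apply/eqP.
by apply/negPn/negP => h; apply: (h2 j m h); exact: h1.
Qed.

Lemma linear_mulmxr n n' (M : 'M[S]_(n, n')) :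
  linear ((fun v : 'rV[S]_n => v *m M) : mvec n -> mvec n').
Proof. by move=> a u v; rewrite !restr_scaleE mulmxDl scalemxAl. Qed.
End Strands.

(** * Betti numbers and the Hilbert function *)

Section Resolution.
Context {k : fieldType} (C : smooth_proj_curve k) (L : line_bundle C).
Context (N : nat) (s : 'I_N -> funfield C) (F : free_resolution L s).
Local Notation K := (funfield C).
Local Notation iota := (scalars C).
Local Notation S := {mpoly k[N]}.
Hypothesis sL : forall j, sections L 1 (s j).

Let d p (v : @mvec k N (frank F p.+1)) : @mvec k N (frank F p) :=
  (v : 'rV[S]__) *m fdiff F p.

Let st p e : set (@mvec k N (frank F p)) := strand (@gdeg _ _ _ _ _ F p) e.

Let dst p Q v : @st p.+1 Q v -> @st p Q (d v).
Proof. by apply: strand_mul => i j m; exact: fdiff_homog. Qed.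

Let dd p v : d (d v : @mvec k N (frank F p.+1)) = 0.
Proof. by apply/(fexact (p := p)); exists v. Qed.

(* The degree e part of a preimage of a homogeneous element is a preimage. *)
Let st_lift p e (v : @mvec k N (frank F p)) w : @st p (eq^~ e) v -> v = d w ->
  exists2 w', @st p.+1 (eq^~ e) w' & d w' = v.
Proof.
move=> hv ew; have [w1 [w2 [h1 h2 e12]]] := strand_split (@gdeg _ _ _ _ _ F p.+1) e w.
exists w1 => //; apply/eqP; rewrite eq_sym -subr_eq0; apply/eqP.
have e2 : v - d w1 = d w2 by rewrite ew e12 /d mulmxDl addrAC subrr add0r.
apply: (strand_disjoint (dg := @gdeg _ _ _ _ _ F p) (e := e)).
  apply: (@subspaceB _ (@mvec k N _) (@st p (eq^~ e))) => //.
    exact: strand_subspace.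
  exact: dst.
by rewrite e2; exact: dst.
Qed.

Let aug (v : @mvec k N (frank F 0)) : {poly K} :=
  \sum_j sym_act s ((v : 'rV[S]__) ord0 j) * faug j.

Let sym_actE f : sym_act s f =
  \sum_(m <- msupp f) (iota f@_m * \prod_j s j ^+ m j) *: 'X^(mdeg m).
Proof.
rewrite /sym_act /mmap; apply: eq_bigr => m _.
rewrite mul_polyC -scalerA; congr (_ *: _); rewrite /mmap1.
rewrite mdegE -prodrXr -scaler_prod; apply: eq_bigr => j _.
by rewrite exprZn.
Qed.

Lemma sectionsM (a b : nat) x y :
  sections L a x -> sections L b y -> sections L (a + b)%N ((x : K) * y).
Proof.
move=> hx hy P; have [x' Ox ->] := hx P; have [y' Oy ->] := hy P.
exists (x' * y'); first exact: (subalgM (stalk_subalg P)).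
by rewrite exprD mulrACA.
Qed.

Lemma sectionsC c : sections L 0 (iota c).
Proof.
move=> P; exists (iota c); last by rewrite mul1r.
exact: (subalgC (stalk_subalg P)).
Qed.

Let sections_mono m : sections L (mdeg m) (\prod_j s j ^+ m j).
Proof.
rewrite mdegE; apply: (big_ind2 (fun a x => sections L a x)).
- by rewrite -(rmorph1 iota); exact: sectionsC.
- by move=> a x b y; exact: sectionsM.
- move=> j _; elim: (m j) => [|n IHn]; first by rewrite expr0 -(rmorph1 iota); exact: sectionsC.
  by rewrite exprS -add1n; exact: sectionsM.
Qed.

(** The augmentation preserves the grading: t^n receives contributions from degree n only. *)
Let aug_coef (Q : int -> Prop) v n : @st 0%N Q v -> (aug v)`_n != 0 -> Q n%:Z.
Proof.
move=> hv; rewrite coef_sum => /sum_neq0 [j]; have := faug_homog j.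
case ej: (gdeg j) => [a|a] /=; last by move=> ->; rewrite mulr0 coef0 eqxx.
move=> [c _ ->]; rewrite -scalerAr coefZ coefMXn.
case: ifP => an; first by rewrite mulr0 eqxx.
rewrite sym_actE coef_sum => h.
have [m mf hm] : exists2 m, m \in msupp ((v : 'rV[S]__) ord0 j) & mdeg m = (n - a)%N.
  apply: contrapT => nex; move: h; rewrite big1_seq ?mulr0 ?eqxx // => m /andP [_ mf].
  rewrite coefZ coefXn; case: eqP => [e|]; rewrite ?mulr0 //.
  by case: nex; exists m.
have := hv j m; rewrite -mcoeff_msupp => /(_ mf); rewrite ej hm; congr Q.
by move: an; lia.
Qed.

Let aug_sections v (e : nat) : @st 0%N (eq^~ e%:Z) v -> sections L e (aug v)`_e.
Proof.
move=> hv; rewrite coef_sum.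
apply: (@subspace_sum _ (restr iota K^o) (sections L e)) => [|j _].
  exact: sections_subspace.
have := faug_homog j.
case ej: (gdeg j) => [a|a] /=.
  move=> [c hc ->]; rewrite -scalerAr coefZ coefMXn; case: ifP => ea.
    by rewrite mulr0; exact: subspace0 (sections_subspace L e).
  rewrite sym_actE coef_sum mulr_sumr.
  apply: (@subspace_sum _ (restr iota K^o) (sections L e)) => [|m _].
    exact: sections_subspace.
  rewrite coefZ coefXn; case: eqP => h; last first.
    by rewrite !mulr0; exact: subspace0 (sections_subspace L e).
  rewrite mulr1 (_ : e = a + (0 + mdeg m))%N; last by lia.
  by apply: sectionsM => //; apply: sectionsM => //; exact: sectionsC.
by move=> ->; rewrite mulr0 coef0; exact: subspace0 (sections_subspace L e).
Qed.

Let sym_actM (f f' : S) : sym_act s (f * f') = sym_act s f * sym_act s f'.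
Proof. exact: (rmorphM (mmap (@polyC K \o iota) (fun j => s j *: 'X))). Qed.

Let sym_actD (f f' : S) : sym_act s (f + f') = sym_act s f + sym_act s f'.
Proof. exact: (rmorphD (mmap (@polyC K \o iota) (fun j => s j *: 'X))). Qed.

Let sym_actC c : sym_act s c%:MP = (iota c)%:P.
Proof. exact: (mmapC _ (@polyC K \o iota)). Qed.

Let augD u v : aug (u + v) = aug u + aug v.
Proof.
rewrite /aug -big_split; apply: eq_bigr => j _ /=.
by rewrite -mulrDl mxE sym_actD.
Qed.

Let aug_linear (e : nat) : linear ((fun v => (aug v)`_e) : _ -> restr iota K^o).
Proof.
move=> a u v; rewrite augD coefD restr_scaleE; congr (_ + _).
rewrite -[RHS]/(iota a * (aug u)`_e) /aug !coef_sum mulr_sumr; apply: eq_bigr => j _.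
by rewrite mxE sym_actM sym_actC -mulrA coefCM.
Qed.

(** Taking the coefficient of t^e in the augmentation identifies H_0 of the degree e strand with
    H^0(eL). *)
Let st0_dim (e h : nat) : dimq (sections L e : set (restr iota K^o)) [set 0] h ->
  dimq (@st 0%N (eq^~ e%:Z)) [set d v | v in @st 1%N (eq^~ e%:Z)] h.
Proof.
apply: (dimq_iso_inv (aug_linear e)).
- exact: strand_subspace.
- exact: subspace_set0.
- exact: sections_subspace.
- by move=> u; exact: aug_sections.
- move=> u hu; have aE : (aug u)`_e = 0 <-> aug u = 0.
    split=> [a0|->]; last by rewrite coef0.
    apply/polyP => n; rewrite coef0; have [->//|ne] := eqVneq n e.
    apply/eqP; apply: contraNT ne => /(aug_coef hu) /= /eqP; rewrite eqz_nat //.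
  split=> [[w _ ew]|/aE /(fexact0 (f0 := F) u) [w ew]]; last exact: st_lift hu ew.
  by apply/aE; apply/(fexact0 (f0 := F) u); exists w; rewrite -ew.
- move=> f hf; have hf' : section_ring L (f *: 'X^e).
    move=> n; rewrite coefZ coefXn; case: eqP => [->|_]; first by rewrite mulr1.
    by rewrite mulr0; exact: subspace0 (sections_subspace L n).
  have [v ev] := faug_surj F hf'.
  have [v1 [v2 [h1 h2 e12]]] := strand_split (@gdeg _ _ _ _ _ F 0%N) e%:Z v.
  exists v1 => //=.
  have : (aug v)`_e = f by rewrite /aug -ev coefZ coefXn eqxx mulr1.
  rewrite e12 augD coefD [X in _ + X](_ : _ = 0) ?addr0 => [->|]; first by rewrite subrr.
  by apply/eqP/negPn/negP => /(aug_coef h2).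
Qed.

(** The degree e strand is exact in positive homological degree, so its Euler characteristic is the
    dimension of H_0. *)
Lemma hilbert_resolution l (e h : nat) : (forall p, (l <= p)%N -> frank F p = 0%N) ->
  dimq (sections L e : set (restr iota K^o)) [set 0] h -> (0 < l)%N ->
  \sum_(p < l) (-1) ^+ p *
     (\sum_(j < frank F p) size (monos N (e%:Z - gdeg j)))%N%:Z = h%:Z.
Proof.
move=> hl hh l0.
rewrite (@euler_char k (fun p => @mvec k N (frank F p)) d (fun p => @st p (eq^~ e%:Z))
  (fun p => (\sum_(j < frank F p) size (monos N (e%:Z - gdeg j)))%N)
  (fun p => if p is 0 then h else 0)%N l).
- case: l l0 {hl} => // l _.
  by rewrite big_ord_recl big1 ?addr0 ?mul1r // => i _; rewrite mulr0.
- by move=> p; exact: linear_mulmxr.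
- by move=> p; exact: strand_subspace.
- by move=> p v; exact: dst.
- by move=> p v _; exact: dd.
- by move=> p; exact: strand_dim.
- exact: st0_dim.
- move=> p; exists (fun=> 0); split=> [[]//|v [hv /= dv]]; exists 0; split; last first.
    by move=> c _; apply/rowP => -[].
  rewrite big_ord0 subr0; have [w ew] := (fexact (p := p) v).1 dv.
  exact: st_lift hv ew.
- by move=> p /hl f0; rewrite big1 // => j _; have := ltn_ord j; lia.
Qed.

Let td p (v : 'rV[k]_(frank F p.+1)) := v *m tor_diff F p.

Lemma tor_diff2 p : tor_diff F p.+1 *m tor_diff F p = 0.
Proof.
rewrite /tor_diff -map_mxM (_ : fdiff F p.+1 *m fdiff F p = 0) ?map_mx0 //.
apply/row_matrixP => i; rewrite row_mul row0.
by apply/(fexact (p := p)); exists (delta_mx 0 i); rewrite rowE.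
Qed.

Lemma tor_piece_subspace p q : subspace (@tor_piece _ _ _ _ _ F p q).
Proof.
split=> [j _|a u v hu hv j jq]; first by rewrite mxE.
by rewrite !mxE hu // hv // mulr0 addr0.
Qed.

Lemma tor_piece_dim p q : dimq (@tor_piece _ _ _ _ _ F p q) [set 0]
  (\sum_(j < frank F p) (gdeg j == q)).
Proof.
pose r := [seq j <- enum 'I_(frank F p) | gdeg j == q].
have -> : (\sum_(j < frank F p) (gdeg j == q))%N = size r.
  by rewrite size_filter -sum1_count big_enum_cond /= -big_mkcond /= sum1_card
    -sum1_card [RHS]big_mkcond /= big_mkcond.
apply: (dimq_seq (b := fun j => delta_mx 0 j)
  (coord := fun v : 'rV[k]_(frank F p) => fun j => v 0 j)).
- by apply: filter_uniq; exact: enum_uniq.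
- by move=> j a u v; rewrite !mxE.
- by move=> i j; rewrite mxE eqxx eq_sym.
- move=> i; rewrite mem_filter => /andP [/eqP iq _] j; apply: contraNeq.
  by rewrite mxE eqxx /=; case: (j =P i) => [->|_]; rewrite ?iq ?eqxx.
- move=> v hv; rewrite [LHS]row_sum_delta big_filter big_enum_cond [RHS]big_mkcond.
  apply: eq_bigr => j _ /=; case: ifP => // /negbT jq.
  by rewrite hv // scale0r.
Qed.

(** Without minimality the number of generators of degree q can exceed the Betti number, but the
    alternating sums agree. *)
Lemma euler_tor l q (beta : nat -> nat) :
  (forall p, (l <= p)%N -> frank F p = 0%N) ->
  (forall p, has_tor_dim F p q (beta p)) ->
  \sum_(p < l) (-1) ^+ p * (\sum_(j < frank F p) (gdeg j == q))%N%:Z =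
  \sum_(p < l) (-1) ^+ p * (beta p)%:Z.
Proof.
move=> hl hb.
apply: (@euler_char k (fun p => 'rV[k]_(frank F p)) td (fun p => @tor_piece _ _ _ _ _ F p q)
  (fun p => (\sum_(j < frank F p) (gdeg j == q))%N) beta l).
- by move=> p a u v; rewrite /td mulmxDl scalemxAl.
- by move=> p; exact: tor_piece_subspace.
- move=> p v hv j jq; rewrite mxE big1 // => i _.
  have [iq|iq] := eqVneq (gdeg i) q; last by rewrite hv ?mul0r.
  rewrite mxE; have [->|nz] := eqVneq ((fdiff F p i j)@_0%MM) 0; first by rewrite mulr0.
  have := fdiff_homog nz; rewrite mdeg0 addr0 iq => e.
  by rewrite e eqxx in jq.
- by move=> p v _; rewrite /td -mulmxA tor_diff2 mulmx0.
- by move=> p; exact: tor_piece_dim.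
- by have := hb 0%N; rewrite /has_tor_dim /= setIT.
- by move=> p; exact: hb.
- by move=> p /hl f0; rewrite big1 // => j _; have := ltn_ord j; lia.
Qed.

End Resolution.

(** Group the generators by degree q: the Hilbert function at e is the sum over q of dim S_(e-q)
    times the Euler characteristic of Tor in degree q, and for e <= 2 only q <= 2 contributes. *)
Lemma betti_hilbert (k : fieldType) (C : smooth_proj_curve k) (L : line_bundle C)
    (beta : nat -> int -> nat) (e h : nat) :
  is_betti_table L beta ->
  (forall p q, q <= 2 -> beta p q != 0%N -> (p, q) \in [:: (0%N, 0); (1%N, 2)]) ->
  dimq (sections L e : set (restr (scalars C) (funfield C)^o)) [set 0] h ->
  (e <= 2)%N ->
  h%:Z = (size (monos (h0 L) e%:Z))%:Z * (beta 0%N 0)%:Z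
         - (size (monos (h0 L) (e%:Z - 2)))%:Z * (beta 1%N 2)%:Z.
Proof.
move=> [s [F [[sL _] hb]]] bsupp hh e2.
(* Adding 2 keeps the places p = 0 and p = 1 within the range of summation. *)
have [l0 hl0] := frank_finite F; pose l := l0.+2.
have hl p : (l <= p)%N -> frank F p = 0%N by move=> lp; apply: hl0; lia.
rewrite -(hilbert_resolution sL hl hh) //.
(* All generator degrees, together with 0 and 2 so that these two terms can be extracted in any
   case. *)
pose qs : seq int := undup (0 :: 2 ::
  flatten [seq [seq gdeg j | j <- enum 'I_(frank F p)] | p <- iota 0 l]).
have gq p (j : 'I_(frank F p)) : (p < l)%N -> gdeg j \in qs.
  move=> pl; rewrite mem_undup !inE; apply/orP; right; apply/orP; right.
  apply/flattenP; exists [seq gdeg j | j <- enum 'I_(frank F p)].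
    by apply/mapP; exists p; rewrite ?mem_iota.
  by apply/mapP; exists j; rewrite ?mem_enum.
pose hS q := (size (monos (h0 L) (e%:Z - q)))%:Z.
have E p : (p < l)%N -> (\sum_(j < frank F p) size (monos (h0 L) (e%:Z - gdeg j)))%N%:Z =
    \sum_(q <- qs) hS q * (\sum_(j < frank F p) (gdeg j == q))%N%:Z.
  move=> pl; rewrite -natz natr_sum.
  under [RHS]eq_bigr => q _ do rewrite -natz natr_sum mulr_sumr.
  rewrite exchange_big; apply: eq_bigr => j _ /=.
  rewrite (bigD1_seq (gdeg j)) ?gq ?undup_uniq //= eqxx mulr1 big1 ?addr0 /hS ?natz //.
  by move=> q; rewrite eq_sym => /negbTE ->; rewrite mulr0.
under eq_bigr => p _ do rewrite (E _ (ltn_ord p)) mulr_sumr.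
rewrite exchange_big /=.
have Eq q : \sum_(p < l) (-1) ^+ p * (hS q * (\sum_(j < frank F p) (gdeg j == q))%N%:Z) =
    hS q * \sum_(p < l) (-1) ^+ p * (beta p q)%:Z.
  rewrite -(euler_tor hl (fun p => hb p q)) mulr_sumr.
  by apply: eq_bigr => p _; rewrite mulrCA.
under eq_bigr do rewrite Eq.
have bz p q : q <= 2 -> (p, q) \notin [:: (0%N, 0); (1%N, 2)] -> beta p q = 0%N.
  by move=> q2; apply: contraNeq; exact: bsupp.
have q0 : (0 : int) \in qs by rewrite mem_undup !inE.
have q2 : (2 : int) \in qs by rewrite mem_undup !inE.
rewrite (bigD1_seq 0) ?undup_uniq //= [X in _ + X]big_mkcond /=.
rewrite [X in _ + X](bigD1_seq (2 : int)) ?undup_uniq //=.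
have -> : \sum_(p < l) (-1) ^+ p * (beta p 0)%:Z = (beta 0%N 0)%:Z.
  rewrite big_ord_recl big1 ?addr0 ?mul1r // => p _; rewrite bz ?mulr0 //.
  by rewrite !inE !xpair_eqE !andbF.
have -> : \sum_(p < l) (-1) ^+ p * (beta p 2)%:Z = - (beta 1%N 2)%:Z.
  rewrite big_ord_recl bz // mulr0 add0r big_ord_recl big1 ?addr0 ?mulN1r //.
  by move=> p _; rewrite bz ?mulr0 // !inE !xpair_eqE !andbF.
rewrite big1 => [|q nq2]; first by rewrite addr0 /hS subr0 mulrN.
case: ifP => // nq0.
have [le2|gt2] := leP q 2.
  rewrite big1 ?mulr0 // => p _; rewrite bz ?mulr0 //.
  by rewrite !inE !xpair_eqE (negbTE nq2) (negbTE nq0) !andbF.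
rewrite /hS (_ : monos _ _ = [::]) ?mul0r //.
have : e%:Z - q < 0 by lia.
by case: (e%:Z - q).
Qed.

(** * Low-degree entries of the pure diagrams *)

Lemma pi_degseqE (r i : nat) : (i < r)%N ->
  pi_degseq r.+1 i = [:: 0, 2 & [seq j%:Z | j <- iota 3 r & j != r.+2 - i]%N].
Proof.
move=> ir; rewrite /pi_degseq.
have -> : (r.+1 - i + 1 = r.+2 - i)%N by lia.
(* Here r + 1 plays the role of r_d; since i < r the omitted degree r + 2 - i is at least 3, so the
   sequence starts with 0, 2. *)
have [a ea] : exists a, (r.+2 - i = a.+3)%N by exists (r - i.+1)%N; lia.
rewrite ea /=; congr [:: _, _ & map _ _]; apply: eq_in_filter => j.
by rewrite mem_iota => /andP [j3 _]; rewrite (_ : j != 1%N) //; lia.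
Qed.

Section PureDiagrams.
Variables (r i : nat).
Hypothesis ir : (i < r)%N.
Let rest := [seq j <- iota 3 r | j != r.+2 - i]%N.
Let e := pi_degseq r.+1 i.

Let size_e : size e = r.+1.
Proof.
rewrite /e pi_degseqE //= size_map size_filter.
have := count_predC (fun j => j != r.+2 - i)%N (iota 3 r); rewrite size_iota.
have -> : count (predC (fun j => j != r.+2 - i)%N) (iota 3 r) = 1%N; last first.
  by rewrite addn1 => ->.
rewrite (eq_count (a2 := pred1 (r.+2 - i)%N)); last by move=> j /=; rewrite negbK.
by rewrite count_uniq_mem ?iota_uniq // mem_iota; case: andP => //; lia.
Qed.

Lemma pure_diagram_supp p q : q <= 2 -> pure_diagram e p q != 0 ->
  (p, q) \in [:: (0%N, 0); (1%N, 2)].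
Proof.
move=> q2; rewrite /pure_diagram; case: ifP => [/andP [ps /eqP eq] _|]; last by rewrite eqxx.
move: q2; rewrite eq; move: ps; rewrite size_e /e pi_degseqE //.
case: p {eq} => [|[|p]] // ps /= h; exfalso.
have ps' : (p < size [seq j <- iota 3 r | j != r.+2 - i]%N)%N.
  by move: size_e; rewrite /e pi_degseqE //= size_map; lia.
have := mem_nth 0%N ps'; rewrite mem_filter mem_iota => /andP [_ /andP [h3 _]].
by move: h; rewrite (nth_map 0%N) //= lez_nat leqNgt h3.
Qed.

(** Restoring the factor of the omitted degree makes the product over all of 3, ..., r + 2, hence a
    factorial up to a factor; the restored factor is the numerator of the entry. *)
Let prod_rest (f : nat -> rat) :
  f (r.+2 - i)%N * \prod_(j <- rest) f j = \prod_(j <- iota 3 r) f j.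
Proof.
rewrite big_filter [RHS](bigD1_seq (r.+2 - i)%N) ?iota_uniq //= mem_iota.
by apply/andP; lia.
Qed.

Let prod_e (p : nat) (G : int -> rat) : (p < 2)%N ->
  \prod_(0 <= l < size e | l != p) G e`_l =
  G (if p is 0 then 2 else 0)%N%:Z * \prod_(j <- rest) G j%:Z.
Proof.
move=> p2.
have -> : \prod_(j <- rest) G j%:Z = \prod_(x <- [seq j%:Z | j <- rest]) G x.
  by rewrite big_map.
rewrite big_mkcond /e pi_degseqE // -/rest; set s := [seq _ | j <- rest].
rewrite [size _]/= big_nat_recl // big_nat_recl // [in RHS](big_nth 0) /= mulrA.
congr (_ * _).
  by case: p p2 => [|[|p]] // _; rewrite ?mul1r ?mulr1.
by apply: eq_bigr => l _; case: p p2 => [|[|p]].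
Qed.

Let iotaE n : iota 3 n.+1 = rcons (iota 3 n) n.+3.
Proof. by rewrite -cats1 -[n.+1 in LHS]addn1 iotaD. Qed.

Let fact_prod : \prod_(j <- iota 3 r) j%:R * 2 = (r.+2)`!%:R :> rat.
Proof.
elim: (r) => [|n IHn]; first by rewrite big_nil mul1r.
rewrite iotaE -cats1 big_cat big_seq1 /= mulrAC IHn mulrC -natrM.
by rewrite [in RHS]factS.
Qed.

Let fact_prod2 : \prod_(j <- iota 3 r) (j%:R - 2) = r`!%:R :> rat.
Proof.
elim: (r) => [|n IHn]; first by rewrite big_nil.
rewrite iotaE -cats1 big_cat big_seq1 /= IHn mulrC factS natrM; congr (_ * _).
by rewrite -[n.+3]addn2 -addn1 !natrD; ring.
Qed.

Let rest_ge3 j : j \in rest -> (3 <= j)%N.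
Proof. by rewrite mem_filter mem_iota => /andP [_ /andP []]. Qed.

Lemma pure_diagram00 :
  pure_diagram e 0 0 = (r.+2%:R - i%:R) / (r.+1%:R * r.+2%:R).
Proof.
have e0 : e`_0 = 0 by rewrite /e pi_degseqE.
rewrite /pure_diagram e0 size_e eqxx /= -{1}size_e.
rewrite (prod_e (fun x => `|x - 0|%:~R^-1)) //=.
have -> : \prod_(j <- rest) (`|j%:Z - 0|%:~R^-1 : rat) = (\prod_(j <- rest) j%:R)^-1.
  by rewrite -prodfV; apply: eq_bigr => j _; rewrite subr0.
have p0 : \prod_(j <- rest) (j%:R : rat) != 0.
  rewrite prodf_seq_neq0; apply/allP => j /rest_ge3 h; rewrite pnatr_eq0 /=; lia.
have := prod_rest (fun j => j%:R); rewrite natrB; last by lia.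
move=> h; have := fact_prod; rewrite -h !factS !natrM => e1.
have r1 : (r.+1%:R : rat) != 0 by rewrite pnatr_eq0.
have r2 : (r.+2%:R : rat) != 0 by rewrite pnatr_eq0.
have rf : (r`!%:R : rat) != 0 by rewrite pnatr_eq0 -lt0n fact_gt0.
apply: (mulIf p0); apply: (mulIf r1); apply: (mulIf r2).
rewrite (_ : `|2 - 0|%:~R = 2 :> rat) //.
transitivity ((r.+2%:R * (r.+1%:R * r`!%:R)) / 2 : rat).
  by move: (r.+1%:R) (r.+2%:R) => x y; field.
by rewrite -e1; move: (r.+1%:R) (r.+2%:R) r1 r2 => x y x0 y0; field; rewrite y0 x0.
Qed.

Lemma pure_diagram12 : pure_diagram e 1 2 = (r%:R - i%:R) / 2.
Proof.
have e1 : e`_1 = 2 by rewrite /e pi_degseqE.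
rewrite /pure_diagram e1 size_e eqxx /= (_ : (1 < r.+1)%N); last by lia.
rewrite /= -{1}size_e (prod_e (fun x => `|x - 2|%:~R^-1)) //=.
have -> : \prod_(j <- rest) (`|j%:Z - 2|%:~R^-1 : rat) =
    (\prod_(j <- rest) (j%:R - 2))^-1.
  rewrite -prodfV big_seq [RHS]big_seq; apply: eq_bigr => j /rest_ge3 h.
  by rewrite ger0_norm ?rmorphB //=; lia.
have p0 : \prod_(j <- rest) (j%:R - 2 : rat) != 0.
  rewrite prodf_seq_neq0; apply/allP => j /rest_ge3 h /=.
  by rewrite subr_eq0 eqr_nat; lia.
have := prod_rest (fun j => j%:R - 2); rewrite natrB; last by lia.
rewrite fact_prod2 => <-; rewrite (_ : `|0 - 2|%:~R = 2 :> rat) //.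
by rewrite -[r.+2]addn2 natrD; field.
Qed.
End PureDiagrams.

(** * From Betti numbers to the coefficients *)

Lemma BS_coefficient_sums (k : fieldType) (C : smooth_proj_curve k) (g : nat)
    (L : line_bundle C) (beta : nat -> int -> nat) (c : 'I_g.+1 -> rat) (h2 : nat) :
  (2 * g + 4)%:Z <= degree L ->
  (h0 L)%:Z = degree L + 1 - g%:Z ->
  dimq (sections L 2 : set (restr (scalars C) (funfield C)^o)) [set 0] h2 ->
  h2%:Z = 2 * degree L + 1 - g%:Z ->
  is_betti_table L beta ->
  BS_decomposition (fun p q => (degree L)%:~R^-1 * (beta p q)%:R)
    (fun i : 'I_g.+1 => pi_degseq (h0 L).-1 i) c ->
  \sum_i c i = 1 /\
  \sum_(i < g.+1) c i * (g%:R - i%:R) = (g ^ 2 - g)%:R / (degree L)%:~R.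
Proof.
move=> dL eh0 hh2 eh2 hbeta [c0 _ _ _ hT].
(* r is r_d - 1, the index shift used for the pure diagrams; the bound on the degree puts every i <=
   g below r. *)
have [r er] : exists r, h0 L = r.+2 by exists (h0 L).-2; lia.
have ir (i : 'I_g.+1) : (i < r)%N by have := ltn_ord i; lia.
rewrite er /= in hT.
have d0 : ((degree L)%:~R : rat) != 0 by rewrite intr_eq0; lia.
have bsupp p q : q <= 2 -> beta p q != 0%N -> (p, q) \in [:: (0%N, 0); (1%N, 2)].
  move=> q2 bpq; have : ((degree L)%:~R^-1 * (beta p q)%:R : rat) != 0.
    by rewrite mulf_neq0 ?invr_neq0 // pnatr_eq0.
  rewrite hT => /sum_neq0 [i]; rewrite mulf_eq0 negb_or => /andP [_].
  exact: pure_diagram_supp.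
have b00 : beta 0%N 0 = 1%N.
  have := betti_hilbert hbeta bsupp (sections0_dim L) isT.
  rewrite er (size_monos r.+1 0) bin0 /=; lia.
have b12 : ((beta 1%N 2)%:R : rat) = 'C(r.+3, 2)%:R - h2%:R.
  have := betti_hilbert hbeta bsupp hh2 isT.
  rewrite er (size_monos r.+1 2) b00 (_ : 2%:Z - 2 = 0%:Z) // (size_monos r.+1 0) bin0 => e.
  have -> : (h2%:R : rat) = h2%:Z%:~R by [].
  rewrite e rmorphB !rmorphM /= mulr1 mul1r; ring.
have bin3 : ('C(r.+3, 2)%:R : rat) * 2 = r.+3%:R * r.+2%:R.
  by rewrite bin2 -natrM muln2 halfK -natrM oddM /= andNb subn0.
have eA : \sum_i c i * (r.+2%:R - i%:R) = r.+1%:R * r.+2%:R / (degree L)%:~R.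
  have := hT 0%N 0; rewrite b00 mulr1.
  under eq_bigr => i _ do rewrite pure_diagram00 // mulrA.
  rewrite -mulr_suml => ->; rewrite mulrA mulrC mulKf // mulf_neq0 // pnatr_eq0 //.
have eB : \sum_i c i * (r%:R - i%:R) = (beta 1%N 2)%:R * 2 / (degree L)%:~R.
  have := hT 1%N 2.
  under eq_bigr => i _ do rewrite pure_diagram12 // mulrA.
  by rewrite -mulr_suml mulrAC [_^-1 * _]mulrC => ->; rewrite divfK.
have rE : (r%:R : rat) = (degree L)%:~R - g%:R - 1.
  have -> : (r%:R : rat) = r%:Z%:~R by [].
  have -> : (g%:R : rat) = g%:Z%:~R by [].
  rewrite -(rmorph1 intr) -!rmorphB /=; congr _%:~R; lia.
have h2E : (h2%:R : rat) = 2 * (degree L)%:~R + 1 - g%:R.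
  have -> : (h2%:R : rat) = h2%:Z%:~R by [].
  by rewrite eh2 rmorphB rmorphD rmorphM /=.
have r1E : (r.+1%:R : rat) = r%:R + 1 by rewrite -addn1 natrD.
have r2E : (r.+2%:R : rat) = r%:R + 2 by rewrite -addn2 natrD.
have r3E : (r.+3%:R : rat) = r%:R + 3 by rewrite -addn3 natrD.
have S1 : \sum_i c i = 1.
  (* Both entries are affine in i with the same slope up to scaling, so their difference isolates
     the total mass. *)
  have e : \sum_i c i * (r.+2%:R - i%:R) - \sum_i c i * (r%:R - i%:R) = 2 * \sum_i c i.
    rewrite -sumrB mulr_sumr; apply: eq_bigr => i _.
    by rewrite r2E; ring.
  move: e; rewrite eA eB b12 mulrBl bin3 r1E r2E r3E h2E rE.
  move=> e; apply: (mulfI (_ : (2 : rat) != 0)) => //; rewrite -e.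
  by move: ((degree L)%:~R : rat) d0 => x x0; field.
split=> //.
have -> : \sum_(i < g.+1) c i * (g%:R - i%:R) =
    \sum_i c i * (r.+2%:R - i%:R) - (r.+2%:R - g%:R) * \sum_i c i.
  by rewrite mulr_sumr -sumrB; apply: eq_bigr => i _; ring.
rewrite eA S1 natrB ?natrX; last by case: (g) => // n; rewrite expnS expn1 leq_pmulr.
by rewrite r1E r2E rE; move: ((degree L)%:~R : rat) d0 => x x0; field.
Qed.

(** Strict growth of integers is growth by at least 1 at each step. *)
Lemma increasing_ge (u : nat -> int) : (forall d d', (0 < d < d')%N -> u d < u d') ->
  0 < u 1%N -> forall d, (0 < d)%N -> d%:Z <= u d.
Proof.
move=> inc u1; elim=> // d IHd _; case: d IHd => [|d] IHd; first by lia.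
have := IHd isT; have := inc d.+1 d.+2; rewrite ltnSn => /(_ isT); lia.
Qed.

Theorem theorem2p3 (k : fieldType) (C : smooth_proj_curve k) (g : nat)
    (hg : has_genus C g)
    (A : nat -> line_bundle C)
    (hAincr : forall d d', (0 < d < d')%N -> degree (A d) < degree (A d'))
    (hAdeg : forall d, (0 < d)%N -> (2 * g + 1)%:Z <= degree (A d))
    (beta : nat -> nat -> int -> nat)
    (hbeta : forall d, (0 < d)%N -> is_betti_table (A d) (beta d))
    (c : nat -> 'I_g.+1 -> rat)
    (hc : forall d, (0 < d)%N ->
       BS_decomposition
         (fun p q => (degree (A d))%:~R^-1 * (beta d p q)%:R)
         (fun i : 'I_g.+1 => pi_degseq (h0 (A d)).-1 i)
         (c d)) :
  forall i : 'I_g.+1,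
    rat_cvg (fun d => c d i) (if i == g :> nat then 1 else 0).
Proof.
have [d0 hd0] := sections_dim_large hg.
have dge := increasing_ge hAincr; have {}dge d : (0 < d)%N -> d%:Z <= degree (A d).
  by apply: dge; have := hAdeg 1%N isT; lia.
move=> i eps eps0.
have [M hM] : exists M : nat, (g ^ 2)%:R < eps * M%:R.
  exists (Num.bound ((g ^ 2)%:R / eps)); rewrite mulrC -ltr_pdivrMr //.
  by apply: archi_boundP; rewrite divr_ge0 // ltW.
(* Since deg A_d >= d, this secures at once the range of Riemann-Roch, the condition i < r, and g^2
   / deg A_d < eps. *)
exists (2 * g + 4 + `|d0| + M)%N => d dM.
have dpos : (0 < d)%N by lia.
have dd := dge d dpos.
have [d0d gd] : d0 <= degree (A d) /\ (2 * g + 4)%:Z <= degree (A d) by split; lia.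
have [eh0 hS] := hd0 (A d) d0d.
have [h2 hh2 eh2] := hS 2%N isT.
have [S0 S1] := BS_coefficient_sums gd eh0 hh2 eh2 (hbeta d dpos) (hc d dpos).
have [c0 _ _ _ _] := hc d dpos.
pose w := \sum_(i < g.+1) c d i * (g%:R - i%:R).
have wlt : w < eps.
  rewrite /w S1 ltr_pdivrMr; last by rewrite ltr0z; lia.
  apply: (@le_lt_trans _ _ (g ^ 2)%:R); first by rewrite ler_nat leq_subr.
  apply: lt_le_trans hM _; rewrite ler_pM2l // -[M%:R]/(M%:Z%:~R) ler_int; lia.
have ci_le (j : 'I_g.+1) : 0 <= c d j * (g%:R - j%:R).
  by rewrite mulr_ge0 // subr_ge0 ler_nat -ltnS.
have cj (j : 'I_g.+1) : (j < g)%N -> c d j <= c d j * (g%:R - j%:R).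
  move=> jg; rewrite -{1}[c d j]mulr1 ler_wpM2l // lerBrDr addrC natr1.
  by rewrite ler_nat.
(* For i = g, the defect 1 - c_g is the sum of the other coefficients, each bounded by its own term
   of w; for i < g, c_i is bounded by a single term of w. *)
case: eqP => ig.
  have e : 1 - c d i = \sum_(j < g.+1 | j != i) c d j.
    by rewrite -S0 (bigD1 i) //= addrAC subrr add0r.
  have s0 : 0 <= 1 - c d i by rewrite e; apply: sumr_ge0.
  rewrite distrC ger0_norm // e; apply: le_lt_trans wlt.
  rewrite /w [leRHS](bigD1 i) //= ig subrr mulr0 add0r; apply: ler_sum => j ji.
  apply: cj; have := ltn_ord j; rewrite ltnS leq_eqVlt => /orP [/eqP jg|] //.
  by case/eqP: ji; apply: val_inj; rewrite /= jg ig.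
rewrite subr0 ger0_norm //; apply: le_lt_trans wlt.
rewrite /w (bigD1 i) //=; apply: (le_trans (cj i _)).
  by have := ltn_ord i; lia.
by rewrite lerDl; apply: sumr_ge0.
Qed.
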